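(* Let $(\mathcal S,\mathcal A,J,P,c)$ be an SSP instance, $s\in\{1,\dots,n\}$, and let $x\in\mathbb R^m$ be a feasible solution of $(P_s)$, i.e. $x\ge0$ and $(J-P)^Tx=e_s$. In strongly polynomial time one can find an integer $1\le k\le m$, vectors $x_1,\dots,x_k,x_c\in\mathbb R^m$ and scalars $\lambda_1,\dots,\lambda_k\in[0,1]$ such that $x_1,\dots,x_k$ are feasible solutions of $(P_s)$, $x_c$ satisfies $(J-P)^Tx_c=0$, $x_c\ge0$, $\sum_{j=1}^k\lambda_j=1$ and $x=\sum_{j=1}^k\lambda_jx_j+x_c$. Moreover, for every $j=1,\dots,k$ there exists a proper (i.e. $s$-proper), deterministic and stationary policy $\Pi_j$ such that $x_j=x^{\Pi_j}$.
   Context: An SSP instance is a tuple $(\mathcal S,\mathcal A,J,P,c)$ with states $\mathcal S=\{0,\dots,n\}$ (target $0$), actions $\mathcal A=\{0,\dots,m\}$ (action $0$ is the unique action at $0$, leading to $0$ with probability 1), $J\in\{0,1\}^{m\times n}$ with $J(a,s)=1$ iff action $a$ is available in state $s$ (each action $a\ge1$ available in exactly one state; $\mathcal A(s)$ the actions available in $s$), $P$ an $m\times n$ row-substochastic matrix with $P(a,s)$ the probability of moving to $s\in\{1,\dots,n\}$ after action $a$ (remaining probability goes to $0$), and $c\in\mathbb R^m$. $e_s$ is the $s$-th unit vector of $\mathbb R^n$. A policy chooses at each time, possibly depending on the history of states and actions, a probability distribution over the actions available at the current state; it is deterministic if these distributions are point masses and stationary if they depend only on the current state. Starting from state $s$ at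 time $0$, $x_k^\Pi\in\mathbb R^m_{\ge0}$ is the vector of probabilities of taking each action $a\in\{1,\dots,m\}$ at time $k$. $\Pi$ is $s$-proper if $\sum_{k\ge0}x_k^\Pi$ is finite, and then $x^\Pi:=\sum_{k\ge0}x_k^\Pi$ (starting from $s$) is its flux vector. *)

(* Defs.v *)
From HB Require Import structures.
From mathcomp Require Import all_boot all_order all_algebra.
From mathcomp Require Import all_classical all_reals all_analysis.

Set Implicit Arguments.
Unset Strict Implicit.
Unset Printing Implicit Defensive.

Import Order.TTheory GRing.Theory Num.Theory.
Import numFieldNormedType.Exports.

Local Open Scope ring_scope.

(** * Stochastic shortest path instances and policies *)

(* The nonzero states 1, .., n are represented by 'I_n and the nonzero actions
   1, .., m by 'I_m (with indices shifted by one). The target state 0 and its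
   unique action 0 only appear in [state] and [action] below, as [None]. *)
Record ssp (R : realType) (n m : nat) := SSP {
  ssp_J : 'M[bool]_(m, n);
  ssp_P : 'M[R]_(m, n);
  ssp_c : 'cV[R]_m;
  ssp_J_unique : forall a, exists! t, ssp_J a t;
  ssp_P_ge0 : forall a t, 0 <= ssp_P a t;
  ssp_P_le1 : forall a, \sum_t ssp_P a t <= 1 }.

Definition ssp_Jmx (R : realType) n m (I : ssp R n m) : 'M[R]_(m, n) :=
  map_mx (fun b : bool => b%:R) (ssp_J I).

Definition balance (R : realType) n m (I : ssp R n m) (x : 'cV[R]_m) : 'cV[R]_n :=
  (ssp_Jmx I - ssp_P I)^T *m x.

Definition nonneg (R : realType) m (x : 'cV[R]_m) : Prop :=
  forall a, 0 <= x a 0.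

Definition feasible (R : realType) n m (I : ssp R n m) (s : 'I_n)
    (x : 'cV[R]_m) : Prop :=
  nonneg x /\ balance I x = delta_mx s 0.

Definition state (n : nat) := option 'I_n.
Definition action (m : nat) := option 'I_m.

Definition available (R : realType) n m (I : ssp R n m)
    (t : state n) (a : action m) : bool :=
  match t, a with
  | None, None => true
  | Some t', Some a' => ssp_J I a' t'
  | _, _ => false
  end.

Definition transition (R : realType) n m (I : ssp R n m)
    (a : action m) (t : state n) : R :=
  match a, t with
  | None, None => 1
  | None, Some _ => 0
  | Some a', Some t' => ssp_P I a' t'
  | Some a', None => 1 - \sum_t' ssp_P I a' t'
  end.

(* Past state-action pairs, the most recent one first. *)
Definition history (n m : nat) := seq (state n * action m).

(* [pol_prob h t a] is the probability of choosing [a] in the current state [t]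
   after the history [h]. Instances are not required to have an available
   action in every state, and no distribution exists where there is none:
   there, and only there, the total mass is not required to be 1 (it is 0, by
   [pol_avail]). *)
Record policy (R : realType) n m (I : ssp R n m) := Policy {
  pol_prob : history n m -> state n -> action m -> R;
  pol_ge0 : forall h t a, 0 <= pol_prob h t a;
  pol_avail : forall h t a, ~~ available I t a -> pol_prob h t a = 0;
  pol_sum1 : forall h t, [exists a, available I t a] ->
    \sum_a pol_prob h t a = 1 }.

Definition deterministic (R : realType) n m (I : ssp R n m)
    (Pi : policy I) : Prop :=
  forall h t, [exists a, available I t a] ->
    exists a, forall b, pol_prob Pi h t b = (b == a)%:R.

Definition stationary (R : realType) n m (I : ssp R n m)
    (Pi : policy I) : Prop :=
  forall h h' t a, pol_prob Pi h t a = pol_prob Pi h' t a.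

(* Probability that the process started in [s] has history [h] and is then in
   state [t] (at time [size h]). *)
Fixpoint reach_prob (R : realType) n m (I : ssp R n m) (Pi : policy I)
    (s : 'I_n) (h : history n m) (t : state n) : R :=
  match h with
  | [::] => (t == Some s)%:R
  | (u, a) :: h' =>
      reach_prob Pi s h' u * pol_prob Pi h' u a * transition I a t
  end.

(* The vector x_k of the probabilities of taking each action at time [k]. *)
Definition action_prob (R : realType) n m (I : ssp R n m) (Pi : policy I)
    (s : 'I_n) (k : nat) : 'cV[R]_m :=
  \col_(a < m) \sum_(h : k.-tuple (state n * action m)) \sum_(t : state n)
    reach_prob Pi s h t * pol_prob Pi h t (Some a).

Definition flux_series (R : realType) n m (I : ssp R n m) (Pi : policy I)
    (s : 'I_n) (a : 'I_m) : R^nat :=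
  series (fun k => action_prob Pi s k a 0).

Definition proper_policy (R : realType) n m (I : ssp R n m) (Pi : policy I)
    (s : 'I_n) : Prop :=
  forall a, cvgn (flux_series Pi s a).

Definition flux (R : realType) n m (I : ssp R n m) (Pi : policy I)
    (s : 'I_n) : 'cV[R]_m :=
  \col_(a < m) limn (flux_series Pi s a).

(** * The arithmetic model of computation

  A program is a finite text in a structured language for a real RAM, fixed
  once and for all, hence independent of the input and of its dimensions.
  Memory consists of countably many one-dimensional arrays of naturals, used
  for indices and counters, and of countably many two-dimensional arrays of
  reals. A step performs at most one arithmetic operation on reals. The only
  operations on naturals are successor and predecessor, so that in each step
  they grow by at most a constant that depends on the program only. *)

Inductive nexp :=
  | NConst of nat
  | NRead of nat & nexp
  | NSucc of nexp
  | NPred of nexp.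

(* Array name, row index, column index. *)
Inductive rloc := RLoc of nat & nexp & nexp.

Inductive rop := RAdd | RSub | RMul | RDiv.

Inductive test :=
  | TNle of nexp & nexp
  | TRle of rloc & rloc
  | TNot of test
  | TAnd of test & test.

Inductive cmd :=
  | Skip
  | NWrite of nat & nexp & nexp
  | RConst of rloc & nat
  | RCopy of rloc & rloc
  | ROp of rop & rloc & rloc & rloc
  | Seq of cmd & cmd
  | If of test & cmd & cmd
  | While of test & cmd.

Record store (R : realType) := Store {
  nmem : nat -> nat -> nat;
  rmem : nat -> nat -> nat -> R }.

Fixpoint neval (R : realType) (st : store R) (e : nexp) : nat :=
  match e with
  | NConst k => k
  | NRead a i => nmem st a (neval st i)
  | NSucc e' => (neval st e').+1
  | NPred e' => (neval st e').-1
  end.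

Definition rread (R : realType) (st : store R) (l : rloc) : R :=
  let: RLoc a i j := l in rmem st a (neval st i) (neval st j).

Definition nwrite (R : realType) (st : store R) (a i v : nat) : store R :=
  Store (fun a' i' => if (a' == a) && (i' == i) then v else nmem st a' i')
        (rmem st).

Definition rwrite (R : realType) (st : store R) (l : rloc) (v : R) : store R :=
  let: RLoc a i j := l in
  Store (nmem st)
        (fun a' i' j' =>
           if [&& a' == a, i' == neval st i & j' == neval st j] then v
           else rmem st a' i' j').

(* Division by zero returns zero, the convention of the library. *)
Definition rop_eval (R : realType) (o : rop) (u v : R) : R :=
  match o with
  | RAdd => u + v
  | RSub => u - v
  | RMul => u * v
  | RDiv => u / v
  end.

Fixpoint teval (R : realType) (st : store R) (b : test) : bool :=
  match b with
  | TNle e f => (neval st e <= neval st f)%N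
  | TRle l k => rread st l <= rread st k
  | TNot b' => ~~ teval st b'
  | TAnd b' b'' => teval st b' && teval st b''
  end.

(* The commands that remain to be executed, and the current store. *)
Definition config (R : realType) := (seq cmd * store R)%type.

Definition step (R : realType) (cf : config R) : config R :=
  let: (cs, st) := cf in
  match cs with
  | [::] => ([::], st)
  | Skip :: k => (k, st)
  | NWrite a i e :: k => (k, nwrite st a (neval st i) (neval st e))
  | RConst l v :: k => (k, rwrite st l v%:R)
  | RCopy l u :: k => (k, rwrite st l (rread st u))
  | ROp o l u v :: k =>
      (k, rwrite st l (rop_eval o (rread st u) (rread st v)))
  | Seq c d :: k => (c :: d :: k, st)
  | If b c d :: k => ((if teval st b then c else d) :: k, st)
  | While b c :: k =>
      ((if teval st b then c :: While b c :: k else k), st)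
  end.

Definition run (R : realType) (prog : cmd) (st : store R) (t : nat) : config R :=
  iter t (@step R) ([:: prog], st).

Definition rat_size (q : rat) : nat :=
  (1 + up_log 2 `|numq q|.+1 + up_log 2 `|denq q|.+1)%N.

(* The run of [prog] on the initial store [st], which contains the input
   numbers [nums], satisfies the two requirements of strong polynomiality and
   ends in the store [st'] :
   - the number of steps is at most [p] evaluated at the number of input
     numbers, whatever these real numbers are;
   - if the input numbers are rational, then at any time the numbers in memory
     are rationals of binary size at most [q] evaluated at the binary size of
     the input (at most one cell is written per step, so the space used is
     polynomially bounded). *)
Definition strongly_polynomial_run (R : realType) (prog : cmd)
    (p q : {poly nat}) (st : store R) (nums : seq R) (st' : store R) : Prop :=
  exists T : nat,
    [/\ (T <= p.[size nums])%N,
        run prog st T = ([::], st')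
      & forall rats : seq rat, nums = [seq ratr r | r <- rats] ->
        forall t : nat, (t <= T)%N -> forall a i j : nat,
          exists2 r : rat, rmem (run prog st t).2 a i j = ratr r
            & (rat_size r <= q.[(\sum_(r <- rats) rat_size r)%N])%N].

(** * Input and output conventions *)

Definition mx_cells (R : realType) p q (A : 'M[R]_(p, q)) (i j : nat) : R :=
  match (insub i : option 'I_p), (insub j : option 'I_q) with
  | Some i', Some j' => A i' j'
  | _, _ => 0
  end.

Definition mx_entries (R : realType) p q (A : 'M[R]_(p, q)) : seq R :=
  [seq A i j | i <- enum 'I_p, j <- enum 'I_q].

Definition input_store (R : realType) n m (I : ssp R n m) (s : 'I_n)
    (x : 'cV[R]_m) : store R :=
  Store
    (fun a i => if a == 0%N then nth 0%N [:: n; m; s : nat] i else 0%N)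
    (fun a => match a with
              | 0%N => mx_cells (ssp_Jmx I)
              | 1%N => mx_cells (ssp_P I)
              | 2%N => mx_cells (ssp_c I)
              | 3%N => mx_cells x
              | _ => fun _ _ => 0
              end).

Definition input_numbers (R : realType) n m (I : ssp R n m) (s : 'I_n)
    (x : 'cV[R]_m) : seq R :=
  [:: n%:R; m%:R; (s : nat)%:R] ++ mx_entries (ssp_Jmx I) ++
    mx_entries (ssp_P I) ++ mx_entries (ssp_c I) ++ mx_entries x.

(* The output is read in natural array 1 (the integer k) and in real arrays 4
   (row j is the vector x_j), 5 (the scalars) and 6 (the vector x_c). *)
Definition output_is (R : realType) m (st : store R) (k : nat)
    (xs : 'I_k -> 'cV[R]_m) (lam : 'I_k -> R) (xc : 'cV[R]_m) : Prop :=
  [/\ nmem st 1 0 = k,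
      forall (j : 'I_k) (a : 'I_m), rmem st 4 j a = xs j a 0,
      forall j : 'I_k, rmem st 5 j 0%N = lam j
    & forall a : 'I_m, rmem st 6 a 0%N = xc a 0].

(* Main.v *)
Require Import Defs.
From HB Require Import structures.
From mathcomp Require Import all_boot all_order all_algebra.
From mathcomp Require Import all_classical all_reals all_analysis.
From mathcomp Require Import perm ring lra zify.

Set Implicit Arguments.
Unset Strict Implicit.
Unset Printing Implicit Defensive.

Import Order.TTheory GRing.Theory Num.Theory.
Import numFieldNormedType.Exports.

Local Open Scope ring_scope.

(* Repeatedly choose a proper deterministic stationary policy inside the support
   of the remaining flow and subtract the largest multiple of its flux vector
   that keeps the flow nonnegative: an action leaves the support each time, so
   there are at most m rounds, and when the remaining source mass vanishes the
   remaining flow is x_c.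

   A policy is grown from the empty one, adding a state t with an action of the
   support that reaches the target or an earlier state with positive
   probability. When nothing can be added, flow conservation over the remaining
   states shows that s has been reached and that the chosen actions never leave
   the states added so far. Adding a state changes one row of 1 - P_pi, so its
   inverse N is maintained by rank-one updates, and row s of N is the flux.

   All stored numbers stay small without any gcd computation: the entries of N
   have the common denominator det (D (1 - P_pi)) by Cramer's rule, where D is a
   common denominator of the input, and subtracting from the flow multiplies
   its common denominator by a single numerator. The remaining mass is a linear
   function of the flow. *)

(** * Structured programs with bounded loops *)

(** The size requirement concerns every number in memory at every step, so it is not a property of
    the result: the program logic carries a predicate that each written real must satisfy, and
    correctness and size are proved in one pass. The running time is read off the syntax, since the
    loops are counted by the dimensions alone.

    Bounds obtained by following the arithmetic of successive updates would compound exponentially.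
    Each bound is therefore drawn from a closed description of the current value: a determinant for
    [N], a product of at most [m] numerators for the flow, the balance equation for the mass.

    An action of the support may lead outside the domain with positive probability, so the
    intermediate policies need not be proper. What is preserved is weaker: from each state of the
    domain, ending in a state without a choice is not certain. This keeps the denominators of the
    updates positive; closedness is obtained only at the end, from flow conservation. *)

Inductive fcmd :=
  | FSkip
  | FNat of nat & nexp & nexp
  | FConst of rloc & nat
  | FCopy of rloc & rloc
  | FOp of rop & rloc & rloc & rloc
  | FSeq of fcmd & fcmd
  | FIf of test & fcmd & fcmd
  | FFor of nat & nat & fcmd.

Definition nvar (v : nat) : nexp := NRead v (NConst 0).

(* [FFor v b c] runs [c] with the counter in cell 0 of the natural array [v]
   ranging below the value of cell [b] of the natural array 0. *)
Fixpoint compile (c : fcmd) : cmd :=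
  match c with
  | FSkip => Skip
  | FNat a i e => NWrite a i e
  | FConst l v => RConst l v
  | FCopy l u => RCopy l u
  | FOp o l u v => ROp o l u v
  | FSeq c d => Seq (compile c) (compile d)
  | FIf b c d => If b (compile c) (compile d)
  | FFor v b c =>
      Seq (NWrite v (NConst 0) (NConst 0))
        (While (TNot (TNle (NRead 0 (NConst b)) (nvar v)))
           (Seq (compile c) (NWrite v (NConst 0) (NSucc (nvar v)))))
  end.

Fixpoint nmods (c : fcmd) : seq nat :=
  match c with
  | FNat a _ _ => [:: a]
  | FSeq c d | FIf _ c d => nmods c ++ nmods d
  | FFor v _ c => v :: nmods c
  | _ => [::]
  end.

Definition rloc_name (l : rloc) : nat := let: RLoc a _ _ := l in a.

Fixpoint rmods (c : fcmd) : seq nat :=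
  match c with
  | FConst l _ | FCopy l _ | FOp _ l _ _ => [:: rloc_name l]
  | FSeq c d | FIf _ c d => rmods c ++ rmods d
  | FFor _ _ c => rmods c
  | _ => [::]
  end.

(** Array 0 holds the loop bounds. As the body changes neither it nor the counter, a loop makes
    exactly as many iterations as its bound says at entry. *)
Fixpoint wf (c : fcmd) : bool :=
  match c with
  | FSeq c d | FIf _ c d => wf c && wf d
  | FFor v _ c =>
      [&& v != 0%N, 0%N \notin nmods c, v \notin nmods c & wf c]
  | _ => true
  end.

(** The variable stands for an upper bound on all loop bounds. Both branches of a conditional are
    added because a maximum is not a polynomial. A loop pays 3 for its [Seq], the initial write and
    the last test; an iteration pays 3 for its test, its [Seq] and the increment. *)
Fixpoint time (c : fcmd) : {poly nat} :=
  match c with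
  | FSeq c d | FIf _ c d => 1 + time c + time d
  | FFor _ _ c => 3%:R + (time c + 3%:R) * 'X
  | _ => 1
  end.

(** * Weakest preconditions with a condition on every written real, and their soundness *)

Section WeakestPrecondition.
Variables (R : realType) (G : R -> Prop).
Implicit Types (st : store R) (Q : store R -> Prop) (c : fcmd).

Definition nincr (v : nat) st : store R := nwrite st v 0 (nmem st v 0).+1.

(** A loop is unfolded as often as its bound says at entry, so termination needs no variant; for
    [wf] programs this agrees with the compiled [While]. *)
Fixpoint wp c Q st {struct c} : Prop :=
  match c with
  | FSkip => Q st
  | FNat a i e => Q (nwrite st a (neval st i) (neval st e))
  | FConst l v => G v%:R /\ Q (rwrite st l v%:R)
  | FCopy l u => G (rread st u) /\ Q (rwrite st l (rread st u))
  | FOp o l u v =>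
      let r := rop_eval o (rread st u) (rread st v) in
      G r /\ Q (rwrite st l r)
  | FSeq c d => wp c (wp d Q) st
  | FIf b c d => if teval st b then wp c Q st else wp d Q st
  | FFor v b c =>
      iter (nmem st 0 b) (fun Q' st' => wp c (fun st'' => Q' (nincr v st'')) st')
        Q (nwrite st v 0 0)
  end.

Lemma wp_mono c Q Q' st : (forall st', Q st' -> Q' st') -> wp c Q st -> wp c Q' st.
Proof.
elim: c Q Q' st => /=.
- by move=> Q Q' st; apply.
- by move=> a i e Q Q' st QQ'; apply: QQ'.
- by move=> l v Q Q' st QQ' [? /QQ'].
- by move=> l v Q Q' st QQ' [? /QQ'].
- by move=> o l u v Q Q' st QQ' [? /QQ'].
- by move=> c IHc d IHd Q Q' st QQ'; apply: IHc => st'; apply: IHd.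
- by move=> b c IHc d IHd Q Q' st QQ'; case: ifP => _; [apply: IHc|apply: IHd].
- move=> v b c IHc Q Q' st QQ'; move: (nwrite _ _ _ _) => st0.
  by elim: (nmem st 0 b) st0 => [|k IHk] st0 /=; [apply: QQ'|apply: IHc => st'; apply: IHk].
Qed.

Definition frame c st st' : Prop :=
  (forall a, a \notin nmods c -> nmem st' a = nmem st a) /\
  (forall a, a \notin rmods c -> rmem st' a = rmem st a).

Lemma nmem_nwrite st a i v b : b != a -> nmem (nwrite st a i v) b = nmem st b.
Proof. by move=> /negbTE ba /=; apply/funext => j; rewrite ba. Qed.

Lemma rmem_rwrite st l v b : b != rloc_name l -> rmem (rwrite st l v) b = rmem st b.
Proof.
by case: l => a i j /= /negbTE ba; apply/funext => k; apply/funext => p; rewrite ba.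
Qed.

Lemma nmem_rwrite st l v : nmem (rwrite st l v) = nmem st.
Proof. by case: l. Qed.

Lemma rwrite_frame st l v : (forall a, nmem (rwrite st l v) a = nmem st a) /\
  (forall a, a \notin [:: rloc_name l] -> rmem (rwrite st l v) a = rmem st a).
Proof.
by split=> [a|a]; rewrite ?nmem_rwrite // inE => al; rewrite rmem_rwrite.
Qed.

Lemma frame_for0 v b c st : frame (FFor v b c) st (nwrite st v 0 0).
Proof.
by split=> // a; rewrite [nmods _]/= inE negb_or => /andP[av _]; apply: nmem_nwrite.
Qed.

Lemma frame_forS v b c st st0 st1 : frame (FFor v b c) st st0 -> frame c st0 st1 ->
  frame (FFor v b c) st (nincr v st1).
Proof.
move=> [nf0 rf0] [nf rf]; split=> a; last by move=> ha; rewrite -rf0 // -rf.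
move=> ha; rewrite -nf0 //; move: ha; rewrite [nmods _]/= inE negb_or => /andP[av ac].
by rewrite nmem_nwrite // nf.
Qed.

Lemma wp_frame c Q st : wp c Q st -> wp c (fun st' => Q st' /\ frame c st st') st.
Proof.
elim: c Q st => /=.
- by [].
- by move=> a i e Q st Qst; split=> //; split=> // b /=; rewrite inE; apply: nmem_nwrite.
- move=> l v Q st [Gv Qst]; split=> //; split=> //.
  by have [nf rf] := rwrite_frame st l v%:R; split.
- move=> l u Q st [Gv Qst]; split=> //; split=> //.
  by have [nf rf] := rwrite_frame st l (rread st u); split.
- move=> o l u v Q st [Gv Qst]; split=> //; split=> //.
  by have [nf rf] := rwrite_frame st l (rop_eval o (rread st u) (rread st v)); split.
- move=> c IHc d IHd Q st /IHc; apply: wp_mono => st1 [/IHd H [nf rf]].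
  apply: wp_mono H => st2 [Q2 [nf2 rf2]]; split=> //.
  by split=> a /=; rewrite mem_cat negb_or => /andP[ac ad]; rewrite ?nf2 ?nf ?rf2 ?rf.
- move=> b c IHc d IHd Q st; case: ifP => _ => [/IHc|/IHd]; apply: wp_mono;
    move=> st1 [Q1 [nf rf]]; split=> //;
    by split=> a /=; rewrite mem_cat negb_or => /andP[ac ad]; rewrite ?nf ?rf.
- move=> v b c IHc Q st; set st0 := nwrite _ _ _ _.
  have: frame (FFor v b c) st st0 by apply: frame_for0.
  elim: (nmem st 0 b) st0 => [|k IHk] st0 fr0 //= /IHc.
  apply: wp_mono => st1 [H fr1]; apply: (IHk _ _ H).
  exact: frame_forS fr0 fr1.
Qed.

(** The frame is accumulated over the iterations, so an invariant need only speak of the arrays that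
    the body changes. *)
Lemma wp_for (Inv : nat -> store R -> Prop) v b c Q st p :
  wf (FFor v b c) -> nmem st 0 b = p ->
  Inv 0%N (nwrite st v 0 0) ->
  (forall (i : 'I_p) st', nmem st' v 0 = i -> frame (FFor v b c) st st' ->
    Inv i st' -> wp c (fun st'' => Inv i.+1 (nincr v st'')) st') ->
  (forall st', frame (FFor v b c) st st' -> Inv p st' -> Q st') ->
  wp (FFor v b c) Q st.
Proof.
move=> /and4P[v0 c0 cv _] bp Inv0 step fin /=; rewrite bp.
have [j jp]: {j | j = 0%N} by exists 0%N.
have: nmem (nwrite st v 0 0) v 0 = j by rewrite /= !eqxx jp.
have: frame (FFor v b c) st (nwrite st v 0 0) by apply: frame_for0.
move: Inv0; rewrite -{1}jp; move: (nwrite _ _ _ _) => st0.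
have: (p + j = p)%N by rewrite jp addn0.
(* Induction on the number [k] of iterations left, with [k + j = p] kept while the counter [j] goes
   up. *)
elim: {1 3}p j st0 {jp} => [|k IHk] j st0 kjp I0 fr0 sv /=.
  by apply: fin => //; rewrite -kjp.
have jp : (j < p)%N by rewrite -kjp addSn ltnS leq_addl.
have := @step (Ordinal jp) st0 sv fr0 I0; move/wp_frame; apply: wp_mono => st1 [I1 fr1].
apply: (IHk j.+1) => //; first by rewrite addnS -addSn.
  exact: frame_forS fr0 fr1.
by case: fr1 => nf _; rewrite /nincr /= !eqxx nf // sv.
Qed.

Definition all_good st : Prop := forall a i j, G (rmem st a i j).

(** The continuation [k] is arbitrary so that runs compose under [Seq] and [While]. *)
Definition runs (c : cmd) (T : nat) st st' : Prop :=
  forall k, iter T (@step R) (c :: k, st) = (k, st') /\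
    forall t, (t <= T)%N -> all_good (iter t (@step R) (c :: k, st)).2.

Lemma iter_stepD (T U : nat) (cf : config R) :
  iter (T + U) (@step R) cf = iter U (@step R) (iter T (@step R) cf).
Proof. by rewrite addnC iterD. Qed.

Lemma runs_all_good (c : cmd) T st st' : runs c T st st' -> all_good st'.
Proof. by move=> /(_ [::]) [e /(_ T (leqnn _))]; rewrite e. Qed.

Lemma all_good_rwrite st l v : all_good st -> G v -> all_good (rwrite st l v).
Proof. by case: l => a i j gs gv b k p /=; case: ifP. Qed.

Lemma runs_atomic (c : cmd) st st' : all_good st -> all_good st' ->
  (forall k, step (c :: k, st) = (k, st')) -> runs c 1 st st'.
Proof.
move=> gs gs' E k; split=> [|t]; first exact: E.
by case: t => [|[|t]] // _; rewrite ?[iter 1 _ _]E.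
Qed.

Lemma iter_step_prefix cf cs st T cf' :
  all_good st -> step cf = (cs, st) -> cf.2 = st ->
  (forall t, (t <= T)%N -> all_good (iter t (@step R) (cs, st)).2) ->
  iter T (@step R) (cs, st) = cf' ->
  iter T.+1 (@step R) cf = cf' /\
  forall t, (t <= T.+1)%N -> all_good (iter t (@step R) cf).2.
Proof.
move=> gs E cfE gT ET; split; first by rewrite iterSr E.
by case=> [|t] tT; [rewrite /= cfE|rewrite iterSr E; apply: gT].
Qed.

Lemma iter_step_cat cf1 cf2 cf3 T U :
  iter T (@step R) cf1 = cf2 -> iter U (@step R) cf2 = cf3 ->
  (forall t, (t <= T)%N -> all_good (iter t (@step R) cf1).2) ->
  (forall t, (t <= U)%N -> all_good (iter t (@step R) cf2).2) ->
  iter (T + U) (@step R) cf1 = cf3 /\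
  forall t, (t <= T + U)%N -> all_good (iter t (@step R) cf1).2.
Proof.
move=> E1 E2 g1 g2; split; first by rewrite iter_stepD E1.
move=> t tTU; case: (leqP t T) => [|Tt]; first exact: g1.
by rewrite -(subnKC (ltnW Tt)) iter_stepD E1; apply: g2; rewrite leq_subLR.
Qed.

Lemma runs_seq (c d : cmd) T U st1 st2 st3 : all_good st1 ->
  runs c T st1 st2 -> runs d U st2 st3 -> runs (Seq c d) (T + U).+1 st1 st3.
Proof.
move=> g1 rc rd k; have [ec gc] := rc (d :: k); have [ed gd] := rd k.
have [e g] := iter_step_cat ec ed gc gd.
exact: (@iter_step_prefix _ (c :: d :: k) st1).
Qed.

Lemma runs_if b (c d : cmd) T st1 st2 : all_good st1 ->
  runs (if teval st1 b then c else d) T st1 st2 -> runs (If b c d) T.+1 st1 st2.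
Proof.
move=> g1 rc k; have [e g] := rc k.
exact: (@iter_step_prefix _ ((if teval st1 b then c else d) :: k) st1).
Qed.

Lemma runs_while_true b (c : cmd) T U st1 st2 st3 : all_good st1 -> teval st1 b ->
  runs c T st1 st2 -> runs (While b c) U st2 st3 ->
  runs (While b c) (T + U).+1 st1 st3.
Proof.
move=> g1 tb rc rw k; have [ec gc] := rc (While b c :: k); have [ew gw] := rw k.
have [e g] := iter_step_cat ec ew gc gw.
by apply: (@iter_step_prefix _ (c :: While b c :: k) st1) => //=; rewrite tb.
Qed.

Lemma runs_while_false b (c : cmd) st : all_good st -> ~~ teval st b ->
  runs (While b c) 1 st st.
Proof. by move=> gs tb; apply: runs_atomic => // k /=; rewrite (negbTE tb). Qed.

(** Since array 0 is never written, the initial bound [N] on its cells limits every loop, nested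
    ones included. *)
Lemma wp_runs c Q st N : wf c -> 0%N \notin nmods c -> all_good st ->
  (forall b, (nmem st 0 b <= N)%N) -> wp c Q st ->
  exists T st', [/\ (T <= (time c).[N])%N, runs (compile c) T st st' & Q st'].
Proof.
elim: c Q st => [|a i e|l v|l u|o l u v|c IHc d IHd|b c IHc d IHd|v b c IHc] Q st wfc c0 gs N0.
- move=> Qst; exists 1%N, st; rewrite /= hornerC; split=> //.
  by apply: runs_atomic.
- move=> Qst; exists 1%N, (nwrite st a (neval st i) (neval st e)).
  by rewrite /= hornerC; split=> //; apply: runs_atomic.
- case=> Gv Qst; exists 1%N, (rwrite st l v%:R).
  by rewrite /= hornerC; split=> //; apply: runs_atomic => //; apply: all_good_rwrite.
- case=> Gv Qst; exists 1%N, (rwrite st l (rread st u)).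
  by rewrite /= hornerC; split=> //; apply: runs_atomic => //; apply: all_good_rwrite.
- case=> Gv Qst; exists 1%N, (rwrite st l (rop_eval o (rread st u) (rread st v))).
  by rewrite /= hornerC; split=> //; apply: runs_atomic => //; apply: all_good_rwrite.
- move: wfc c0 => /= /andP[wfc wfd]; rewrite mem_cat negb_or => /andP[c0 d0].
  move=> /wp_frame/(IHc _ _ wfc c0 gs N0) [T [st1 [Tb r1 [w1 [nf1 _]]]]].
  have N1 b : (nmem st1 0 b <= N)%N by rewrite nf1.
  have [U [st2 [Ub r2 Q2]]] := IHd _ _ wfd d0 (runs_all_good r1) N1 w1.
  exists (T + U).+1, st2; split=> //; last exact: runs_seq r1 r2.
  by rewrite !hornerD hornerC; move: Tb Ub; lia.
- move: wfc c0 => /= /andP[wfc wfd]; rewrite mem_cat negb_or => /andP[c0 d0].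
  case: ifP => tb => [/(IHc _ _ wfc c0 gs N0)|/(IHd _ _ wfd d0 gs N0)] [T [st1 [Tb r1 Q1]]];
    exists T.+1, st1; (split=> //; last by apply: runs_if => //; rewrite tb);
    by rewrite !hornerD hornerC; move: Tb; lia.
- move: wfc c0 => /= /and4P[v0 c0 cv wfc] _.
  set body := Seq (compile c) _; set b' := TNot _; set st0 := nwrite st v 0 0.
  have nw0 st' w : nmem (nwrite st' v 0 w) 0 = nmem st' 0.
    by rewrite nmem_nwrite // eq_sym.
  have g0 : all_good st0 by [].
  have N0' d : (nmem st0 0 d <= N)%N by rewrite nw0.
  have loop k st1 : (nmem st1 0 b = nmem st1 v 0 + k)%N -> all_good st1 ->
      (forall d, (nmem st1 0 d <= N)%N) ->
      iter k (fun Q' st' => wp c (fun st'' => Q' (nincr v st'')) st') Q st1 ->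
      exists T st', [/\ (T <= 1 + ((time c).[N] + 3) * k)%N,
        runs (While b' body) T st1 st' & Q st'].
    elim: k st1 => [|k IHk] st1 kE g1 N1.
      move=> Q1; exists 1%N, st1; split=> //; apply: runs_while_false => //.
      by rewrite /= negbK kE addn0.
    rewrite iterS => /wp_frame/(IHc _ _ wfc c0 g1 N1) [T [st2 [Tb r2 [Q2 [nf2 _]]]]].
    have g2 := runs_all_good r2.
    have [|d|U [st3 [Ub r3 Q3]]] := IHk (nincr v st2) _ g2 _ Q2.
      by rewrite /nincr nw0 !nf2 // kE /= !eqxx addnS addSn.
      by rewrite /nincr nw0 nf2.
    exists ((T + 1).+1 + U).+1, st3; split=> //.
      by move: Tb Ub; rewrite mulnS; lia.
    apply: (runs_while_true g1 _ _ r3).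
      by rewrite /= kE -ltnNge addnS ltnS leq_addr.
    apply: (runs_seq g1 r2); exact: runs_atomic.
  move=> w; have := loop (nmem st 0 b) st0; rewrite nw0 /= !eqxx /=.
  case=> // T [st' [Tb r Q']]; exists (1 + T).+1, st'; split=> //.
    rewrite hornerD hornerMX hornerD -polyC_natr !hornerC.
    have := N0 b; move: Tb; set A := (time c).[N]; set B := nmem st 0 b; nia.
  by apply: runs_seq r => //; apply: runs_atomic.
Qed.

End WeakestPrecondition.

(** * Partial policies and rank-one updates *)

Section PartialPolicies.
Variables (R : realType) (n m : nat) (I : ssp R n m).
Implicit Types (pi : {ffun 'I_n -> option 'I_m}) (N : 'M[R]_n) (x : 'cV[R]_m).
Implicit Types (s t u : 'I_n) (a : 'I_m).

Local Notation J := (ssp_J I).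
Local Notation P := (ssp_P I).

Definition policy_mx pi : 'M[R]_n :=
  \matrix_(t, u) if pi t is Some a then P a u else 0.

(** The probability that [a] leads in one step to the target or into the domain of [pi]. *)
Definition leak pi a : R := 1 - \sum_(u | pi u == None) P a u.

Definition extend pi t a : {ffun 'I_n -> option 'I_m} :=
  [ffun u => if u == t then Some a else pi u].

(** For the inverse [N], entry [u] is the expected number of visits to [u] after [a] is taken once
    and [pi] is then followed until a state without a choice is met. *)
Definition pivot_row N a : 'rV[R]_n := row a P *m N.

(* Sherman-Morrison formula for the inverse of [1 - policy_mx (extend pi t a)]. *)
Definition pivot_mx N t a : 'M[R]_n :=
  \matrix_(i, j) (N i j + N i t / (1 - pivot_row N a 0 t) * pivot_row N a 0 j).

Lemma pivot_mxE N t a i j : pivot_mx N t a i j =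
  N i j + N i t / (1 - pivot_row N a 0 t) * pivot_row N a 0 j.
Proof. by rewrite mxE. Qed.

(* For [t] in the domain of [pi], the sum is the probability of leaving the
   domain from [t] other than to the target; that it is less than 1 is what
   keeps the pivots positive. *)
Definition transient pi N : Prop :=
  [/\ N *m (1%:M - policy_mx pi) = 1%:M,
      forall i j, 0 <= N i j
    & forall t, pi t != None -> \sum_(u | pi u == None) N t u < 1].

Lemma policy_mx_extend pi t a : pi t = None ->
  policy_mx (extend pi t a) = policy_mx pi + delta_mx t 0 *m row a P.
Proof.
move=> pit; apply/matrixP => i j; rewrite !mxE big_ord1 !mxE ffunE.
by case: eqP => [->|_]; rewrite ?pit ?mul1r ?mul0r ?add0r ?addr0.
Qed.

(** Row [t] of [policy_mx pi] is zero: the process stops in [t] at once. *)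
Lemma transient_None pi N t u : transient pi N -> pi t = None ->
  N t u = (t == u)%:R.
Proof.
case=> /mulmx1C NP _ _ pit; have /matrixP/(_ t u) := NP.
rewrite !mxE (bigD1 t) //= !mxE eqxx pit subr0 mul1r big1 ?addr0 // => j jt.
by rewrite !mxE pit eq_sym (negbTE jt) subr0 mul0r.
Qed.

Lemma transient0 : transient [ffun => None] 1%:M.
Proof.
split=> [|i j|t]; rewrite ?ffunE // ?mxE ?ler0n //.
rewrite [policy_mx _](_ : _ = 0) ?subr0 ?mulmx1 //.
by apply/matrixP => i j; rewrite !mxE ffunE.
Qed.

Section Extension.
Variables (pi : {ffun 'I_n -> option 'I_m}) (N : 'M[R]_n) (t : 'I_n) (a : 'I_m).
Hypotheses (trN : transient pi N) (pit : pi t = None) (lk : 0 < leak pi a).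

Local Notation w := (pivot_row N a).
Local Notation g i := (\sum_(u | pi u == None) N i u).

(** [g i] is the probability of ending in a state without a choice when starting from [i]. It is 1
    if [i] is such a state; otherwise [transient] gives a strict bound. *)
Lemma exit_le1 i : g i <= 1.
Proof.
case E: (pi i) => [b|].
  by case: trN => _ _ /(_ i); rewrite E => /(_ isT)/ltW.
rewrite (bigD1 i) ?E //= (transient_None _ trN E) eqxx big1 ?addr0 // => u.
by case/andP=> _ /negbTE ui; rewrite (transient_None _ trN E) eq_sym ui.
Qed.

Lemma pivot_row_ge0 u : 0 <= w 0 u.
Proof.
case: trN => _ N0 _; rewrite mxE sumr_ge0 // => j _.
by rewrite mxE mulr_ge0 // ssp_P_ge0.
Qed.

(** Otherwise all the mass of [a] would go to states [j] with [g j = 1], which lie outside the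
    domain by [transient]; then [a] would lead outside with probability 1, and its leak would not be
    positive. *)
Lemma pivot_row_exit : \sum_(u | pi u == None) w 0 u < 1.
Proof.
have -> : \sum_(u | pi u == None) w 0 u = \sum_j P a j * g j.
  rewrite (eq_bigr (fun u => \sum_j P a j * N j u)); last first.
    by move=> u _; rewrite mxE; apply: eq_bigr => j _; rewrite mxE.
  by rewrite exchange_big; apply: eq_bigr => j _; rewrite mulr_sumr.
rewrite ltNge; apply/negP => ge1.
have P0 := ssp_P_ge0 I a; have P1 := ssp_P_le1 I a.
have term j : 0 <= P a j * (1 - g j) by rewrite mulr_ge0 // subr_ge0 exit_le1.
have sum0 : \sum_j P a j * (1 - g j) = 0.
  apply/eqP; rewrite eq_le sumr_ge0 ?andbT //.
  under eq_bigr do rewrite mulrBr mulr1.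
  by rewrite sumrB subr_le0; apply: le_trans ge1.
have PT j : pi j != None -> P a j = 0.
  move=> pij; have /eqP := psumr_eq0P (fun j _ => term j) sum0 (i := j) isT.
  rewrite mulf_eq0 subr_eq0 => /orP[/eqP //|/eqP g1].
  by case: trN => _ _ /(_ j pij); rewrite -g1 ltxx.
move: lk; rewrite /leak subr_gt0 ltNge => /negP; apply.
apply: le_trans ge1 _; rewrite [X in X <= _](bigID (fun j => pi j == None)) /=.
rewrite [X in _ + X]big1 ?addr0; last by move=> j /PT ->; rewrite mul0r.
by apply: ler_sum => j _; rewrite ler_piMr // exit_le1.
Qed.

(** [t] is still outside the domain, so [w 0 t] is one term of the exit sum just bounded. *)
Lemma pivot_gt0 : 0 < 1 - w 0 t.
Proof.
rewrite subr_gt0; apply: le_lt_trans pivot_row_exit.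
rewrite (bigD1 t) ?pit //= lerDl sumr_ge0 // => u _; exact: pivot_row_ge0.
Qed.

Lemma transient_extend : transient (extend pi t a) (pivot_mx N t a).
Proof.
have c0 := pivot_gt0; have [NP N0 gT] := trN; split.
- rewrite policy_mx_extend // opprD addrA.
  have -> : pivot_mx N t a =
      N + (1 - w 0 t)^-1 *: (N *m delta_mx t 0 *m w).
    apply/matrixP => i j; rewrite !mxE; congr (_ + _).
    rewrite big_ord1 -colE !mxE mulrA; congr (_ * _).
    by rewrite mulrC.
  have wP : w *m (1%:M - policy_mx pi) = row a P by rewrite -mulmxA NP mulmx1.
  have wt : w *m delta_mx t 0 = (w 0 t)%:M.
    by rewrite -colE; apply/matrixP => i j; rewrite !ord1 !mxE eqxx.
  have wPt : w *m (1%:M - policy_mx pi - delta_mx t 0 *m row a P) =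
      (1 - w 0 t) *: row a P.
    by rewrite mulmxBr wP mulmxA wt mul_scalar_mx scalerBl scale1r.
  rewrite mulmxDl -scalemxAl -(mulmxA _ w) wPt -scalemxAr scalerA mulVf ?gt_eqF //.
  by rewrite scale1r mulmxBr NP mulmxA subrK.
- move=> i j; rewrite mxE addr_ge0 // mulr_ge0 ?pivot_row_ge0 //.
  by rewrite mulr_ge0 // invr_ge0 ltW.
- move=> i.
  have sumD1 (F : 'I_n -> R) : \sum_(u | extend pi t a u == None) F u =
      \sum_(u | pi u == None) F u - F t.
    rewrite [in RHS](bigD1 t) ?pit //= (addrC (F t)) addrK; apply: eq_bigl => u.
    by rewrite ffunE; case: (u =P t); rewrite ?andbT ?andbF.
  rewrite sumD1 => piti.
  (* The mass [N i t] that stopped in [t] now goes on with [a]. Over all returns to [t], the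
     fraction [(1 - W) / (1 - w 0 t)] of it, with [W] the exit sum of [w], no longer ends outside
     the domain. At old states the exit probability does not increase; at [t] it drops strictly
     below 1. *)
  have -> : \sum_(u | pi u == None) pivot_mx N t a i u - pivot_mx N t a i t =
      g i - N i t * ((1 - \sum_(u | pi u == None) w 0 u) / (1 - w 0 t)).
    under eq_bigr do rewrite pivot_mxE.
    rewrite big_split /= -mulr_sumr pivot_mxE.
    by field; rewrite gt_eqF.
  have d0 : 0 < (1 - \sum_(u | pi u == None) w 0 u) / (1 - w 0 t).
    by rewrite divr_gt0 // subr_gt0 pivot_row_exit.
  move: piti; rewrite ffunE; case: (i =P t) => [-> _|_ pii].
    have := exit_le1 t; rewrite (transient_None t trN pit) eqxx mul1r.
    by move: d0; lra.
  apply: le_lt_trans (gT _ pii).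
  by rewrite lerBlDr lerDl mulr_ge0 // ltW.
Qed.

End Extension.

(** * Flow conservation and closed policies *)

Lemma balanceE x u : balance I x u 0 =
  \sum_a (J a u)%:R * x a 0 - \sum_a P a u * x a 0.
Proof. by rewrite mxE -sumrB; apply: eq_bigr => a _; rewrite !mxE mulrBl. Qed.

Lemma sum_J a (D : pred 'I_n) t : J a t -> \sum_(u | D u) (J a u)%:R = (D t)%:R :> R.
Proof.
move=> Jt; have uni u : J a u -> u = t.
  by have [v [_ uv]] := ssp_J_unique I a; move=> /uv <-; rewrite -(uv _ Jt).
case Dt: (D t).
  rewrite (bigD1 t) //= Jt big1 ?addr0 // => u /andP[_ /eqP ut].
  by case E: (J a u) => //; case: ut; apply: uni.
by rewrite big1 // => u Du; case E: (J a u) => //; move: Du; rewrite (uni _ E) Dt.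
Qed.

Lemma sum_balance x (D : pred 'I_n) : \sum_(u | D u) balance I x u 0 =
  \sum_a x a 0 * (\sum_(u | D u) (J a u)%:R - \sum_(u | D u) P a u).
Proof.
under eq_bigr do rewrite balanceE -sumrB.
rewrite exchange_big; apply: eq_bigr => a _ /=.
by rewrite -sumrB mulr_sumr; apply: eq_bigr => u _; ring.
Qed.

(** In the sum over all states, an action contributes its flow times its probability of moving to
    the target. *)
Lemma balance_ge0 x s mu : nonneg x -> balance I x = mu *: delta_mx s 0 -> 0 <= mu.
Proof.
move=> x0 bx; have := sum_balance x xpredT.
rewrite bx (bigD1 s) //= !mxE !eqxx mulr1 big1 ?addr0; last first.
  by move=> u /negbTE us; rewrite !mxE us mulr0.
move=> ->; apply: sumr_ge0 => a _; rewrite mulr_ge0 //.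
have [t [Jt _]] := ssp_J_unique I a.
by rewrite (sum_J _ Jt) subr_ge0 ssp_P_le1.
Qed.

Definition closed_under pi : Prop :=
  forall t a u, pi t = Some a -> pi u = None -> P a u = 0.

(* Balancing the flow over the complement of the domain of [pi]. *)
Lemma saturated_closed pi x s mu :
  nonneg x -> balance I x = mu *: delta_mx s 0 -> 0 < mu ->
  (forall t a, pi t = Some a -> J a t /\ 0 < x a 0) ->
  (forall a t, J a t -> pi t = None -> 0 < x a 0 -> leak pi a <= 0) ->
  pi s != None /\ closed_under pi.
Proof.
move=> x0 bx mu0 piJ sat.
have := sum_balance x (fun u => pi u == None); rewrite bx.
pose F a := x a 0 * (\sum_(u | pi u == None) (J a u)%:R - \sum_(u | pi u == None) P a u).
rewrite -[RHS]/(\sum_a F a) => bal.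
(* For an action of a state outside the domain, [F a] is its flow times its leak, nonpositive by
   [sat]; for an action of a state inside, it is minus the flow sent outside. *)
have F0 a : F a <= 0.
  rewrite /F; have [t [Jt _]] := ssp_J_unique I a; rewrite (sum_J _ Jt).
  rewrite -[leRHS](mulr0 (x a 0)); case: eqP => pit.
    have := x0 a; rewrite le_eqVlt => /predU1P[<-|xa]; first by rewrite !mul0r.
    by rewrite ler_wpM2l //; apply: (sat a t).
  by rewrite ler_wpM2l // sub0r oppr_le0 sumr_ge0 // => u _; apply: ssp_P_ge0.
have ps : pi s != None.
  apply/negP => ps; move: bal; rewrite (bigD1 s) //= !mxE !eqxx mulr1 big1 ?addr0; last first.
    by move=> u /andP[_ /negbTE us]; rewrite !mxE us mulr0.
  move=> muE; have : mu <= 0 by rewrite muE sumr_le0.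
  by rewrite leNgt mu0.
(* With [s] inside, the total is 0 and so is every term. A chosen action has positive flow, hence
   sends nothing outside. *)
move: bal; rewrite big1; last first.
  move=> u pu; rewrite !mxE; case: (u =P s) => [us|]; last by rewrite mulr0.
  by move: ps; rewrite -us pu.
move=> /esym/eqP; rewrite -oppr_eq0 -sumrN => /eqP sF; split=> // t a u pit pu.
have [Jt xa] := piJ _ _ pit.
have NF b : true -> 0 <= - F b by rewrite oppr_ge0.
have /eqP := psumr_eq0P NF sF (i := a) isT.
rewrite oppr_eq0 mulf_eq0 gt_eqF //= (sum_J _ Jt) pit sub0r oppr_eq0 => /eqP.
by move=> /(psumr_eq0P (fun u _ => ssp_P_ge0 I a u))-> //; apply/eqP.
Qed.

Definition policy_flux pi N s : 'cV[R]_m := \col_a \sum_(t | pi t == Some a) N s t.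

Lemma policy_flux_row pi N s u : transient pi N ->
  N s u = (s == u)%:R + \sum_t N s t * policy_mx pi t u.
Proof.
case=> /matrixP/(_ s u) NP _ _; move: NP; rewrite mulmxBr mulmx1 !mxE.
by move=> <-; rewrite subrK.
Qed.

Lemma policy_flux_diag pi N s : transient pi N -> 0 < N s s.
Proof.
move=> trN; rewrite (policy_flux_row _ _ trN) eqxx ltr_pwDl // sumr_ge0 // => t _.
case: trN => _ N0 _; rewrite mulr_ge0 // mxE.
by case: (pi t) => // a; apply: ssp_P_ge0.
Qed.

Section ClosedFlux.
Variables (pi : {ffun 'I_n -> option 'I_m}) (N : 'M[R]_n) (s : 'I_n).
Hypotheses (trN : transient pi N) (clo : closed_under pi) (ps : pi s != None).
Hypothesis piJ : forall t a, pi t = Some a -> J a t.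

Lemma policy_mx_closed t u : pi u = None -> policy_mx pi t u = 0.
Proof. by move=> pu; rewrite mxE; case E: (pi t) => [a|] //; rewrite (clo E). Qed.

Lemma flux_row_closed u : pi u = None -> N s u = 0.
Proof.
move=> pu; rewrite (policy_flux_row _ _ trN); case: eqP => [su|_].
  by move: ps; rewrite su pu.
by rewrite add0r big1 // => t _; rewrite policy_mx_closed // mulr0.
Qed.

Lemma policy_flux_ge0 : nonneg (policy_flux pi N s).
Proof. by case: trN => _ N0 _ a; rewrite mxE sumr_ge0. Qed.

Lemma pi_inj t u a : pi t = Some a -> pi u = Some a -> t = u.
Proof.
move=> /piJ Jt /piJ Ju; have [v [_ uv]] := ssp_J_unique I a.
by rewrite -(uv _ Jt) (uv _ Ju).
Qed.

Lemma policy_fluxE t a : pi t = Some a -> policy_flux pi N s a 0 = N s t.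
Proof.
move=> pit; rewrite mxE (bigD1 t) ?pit //= big1 ?addr0 // => u /andP[/eqP pu].
by rewrite (pi_inj pu pit) eqxx.
Qed.

Lemma policy_flux_sum (F : 'I_m -> R) :
  \sum_a F a * policy_flux pi N s a 0 =
  \sum_t (if pi t is Some a then F a else 0) * N s t.
Proof.
under eq_bigr do rewrite mxE mulr_sumr big_mkcond /=.
rewrite exchange_big; apply: eq_bigr => t _ /=.
case pit: (pi t) => [b|]; last by rewrite mul0r big1.
rewrite (bigD1 b) //= eqxx big1 ?addr0 // => a /negbTE ab.
by rewrite (inj_eq Some_inj) eq_sym ab.
Qed.

(** The [J] part of the balance gives row [s] of [N] and the [P] part gives that row times
    [policy_mx pi], so this is the equation [N = 1 + N *m policy_mx pi]. *)
Lemma policy_flux_balance : balance I (policy_flux pi N s) = delta_mx s 0.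
Proof.
apply/matrixP => u j; rewrite ord1 balanceE !policy_flux_sum mxE eqxx andbT.
have -> : \sum_t (if pi t is Some a then (J a u)%:R else 0) * N s t = N s u.
  case pu: (pi u) => [b|]; last first.
    rewrite flux_row_closed // big1 // => t _; case pt: (pi t) => [a|]; last by rewrite mul0r.
    case Jt: (J a u); last by rewrite mul0r.
    suff tu : t = u by rewrite -tu pt in pu.
    have [v [_ uv]] := ssp_J_unique I a.
    by rewrite -(uv _ Jt) (uv _ (piJ pt)).
  rewrite (bigD1 u) //= pu (piJ pu) mul1r big1 ?addr0 // => t tu.
  case pt: (pi t) => [a|]; last by rewrite mul0r.
  case Jt: (J a u); last by rewrite mul0r.
  case/eqP: tu; have [v [_ uv]] := ssp_J_unique I a.
  by rewrite -(uv _ Jt) (uv _ (piJ pt)).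
apply/eqP; rewrite subr_eq; apply/eqP.
rewrite (policy_flux_row s u trN) eq_sym; congr (_ + _).
by apply: eq_bigr => t _; rewrite mulrC mxE.
Qed.

End ClosedFlux.

End PartialPolicies.

(** * Flux vectors of deterministic stationary policies *)

Lemma sum_option (R : nmodType) (T : finType) (F : option T -> R) :
  \sum_o F o = F None + \sum_t F (Some t).
Proof.
rewrite (bigD1 None) //=; congr (_ + _).
rewrite (reindex_omap some id) /=; last by case.
by apply: eq_bigl => t; rewrite eqxx.
Qed.

Lemma sum_tuple_cons (R : nmodType) k (T : finType) (F : seq T -> R) :
  \sum_(h : k.+1.-tuple T) F h = \sum_(p : T) \sum_(h : k.-tuple T) F (p :: h).
Proof.
rewrite pair_big /= (reindex (fun ph : T * k.-tuple T => [tuple of ph.1 :: ph.2])) //=.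
exists (fun h : k.+1.-tuple T => (thead h, [tuple of behead h])) => [[p h]|h] _ /=.
  by rewrite theadE; congr (_, _); apply: val_inj.
by rewrite -tuple_eta.
Qed.

Lemma cvgn_sum (R : realType) (T : finType) (D : pred T) (f : T -> R^nat) (l : T -> R) :
  (forall i, D i -> (f i k @[k --> \oo] --> l i)%classic) ->
  (\sum_(i | D i) f i k @[k --> \oo] --> \sum_(i | D i) l i)%classic.
Proof.
move=> fl; apply: cvg_big => //; exact: (@add_continuous R^o).
Qed.

Section StationaryPolicy.
Variables (R : realType) (n m : nat) (I : ssp R n m).
Variable pi : {ffun 'I_n -> option 'I_m}.
Hypothesis piJ : forall t a, pi t = Some a -> ssp_J I a t.

(** [deterministic] asks for a point mass wherever an action is available, so states outside the
    domain get an action too; when the domain is closed they are not reached from [s]. *)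
Definition complete : {ffun 'I_n -> option 'I_m} :=
  [ffun t => if pi t is Some a then Some a else [pick a | ssp_J I a t]].

Definition decision (t : state n) : option (action m) :=
  if t is Some t' then omap some (complete t') else Some None.

Definition decision_prob (h : history n m) (t : state n) (a : action m) : R :=
  (decision t == Some a)%:R.

Lemma decision_prob_ge0 h t a : 0 <= decision_prob h t a.
Proof. exact: ler0n. Qed.

Lemma decision_available t a : decision t = Some a -> available I t a.
Proof.
case: t => [t|] /=; last by case=> <-.
rewrite ffunE; case pit: (pi t) => [b|] /=; first by case=> <-; apply: piJ.
by case: pickP => //= b Jb [<-].
Qed.

Lemma decision_exists t : [exists a, available I t a] ->
  exists a, decision t = Some a.
Proof.
case: t => [t|] /existsP[a] av; last by exists None.
rewrite /= ffunE; case pit: (pi t) => [b|]; first by exists (Some b).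
case: pickP => [b Jb|none]; first by exists (Some b).
by case: a av => //= a; rewrite none.
Qed.

Lemma decision_prob_available h t a : ~~ available I t a -> decision_prob h t a = 0.
Proof.
by rewrite /decision_prob; case: eqP => // /decision_available ->.
Qed.

Lemma decision_probE h t a b : decision t = Some a -> decision_prob h t b = (b == a)%:R.
Proof. by rewrite /decision_prob => ->; rewrite (inj_eq Some_inj) eq_sym. Qed.

Lemma decision_prob_sum1 h t : [exists a, available I t a] ->
  \sum_a decision_prob h t a = 1.
Proof.
case/decision_exists => a ta; rewrite (bigD1 a) //= (decision_probE h a ta) eqxx.
by rewrite big1 ?addr0 // => b /negbTE ba; rewrite (decision_probE h b ta) ba.
Qed.

Definition stationary_policy : policy I :=
  Policy decision_prob_ge0 decision_prob_available decision_prob_sum1.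

Lemma stationary_policy_deterministic : deterministic stationary_policy.
Proof.
by move=> h t /decision_exists[a ta]; exists a => b; apply: decision_probE.
Qed.

Lemma stationary_policy_stationary : stationary stationary_policy.
Proof. by []. Qed.

Section Flux.
Variables (N : 'M[R]_n) (s : 'I_n).
Hypotheses (trN : transient I pi N) (clo : closed_under I pi) (ps : pi s != None).

Local Notation Pi := stationary_policy.
Local Notation A := (policy_mx I pi).

(** The distribution over the nonzero states at time [k]. The matrix of the partial policy suffices,
    since no state outside the closed domain is ever occupied. *)
Fixpoint occupation (k : nat) : 'rV[R]_n :=
  if k is k'.+1 then occupation k' *m A else delta_mx 0 s.

Lemma occupation_ge0 k t : 0 <= occupation k 0 t.
Proof.
elim: k t => [|k IHk] t; first by rewrite mxE ler0n.
rewrite mxE sumr_ge0 // => u _; rewrite mulr_ge0 // mxE.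
by case: (pi u) => // a; apply: ssp_P_ge0.
Qed.

Lemma occupation_closed k t : pi t = None -> occupation k 0 t = 0.
Proof.
move=> pit; case: k => [|k] /=; rewrite mxE.
  by case: (t =P s) => [ts|//]; move: ps; rewrite -ts pit.
by rewrite big1 // => u _; rewrite policy_mx_closed // mulr0.
Qed.

Lemma reach_prob_sum k t :
  \sum_(h : k.-tuple (state n * action m)) reach_prob Pi s h (Some t) = occupation k 0 t.
Proof.
elim: k t => [|k IHk] t.
  rewrite (bigD1 [tuple]) //= big1 ?addr0; last by move=> h; rewrite tuple0.
  by rewrite mxE (inj_eq Some_inj).
rewrite (sum_tuple_cons _ (fun h => reach_prob Pi s h (Some t))) /= mxE.
transitivity (\sum_u \sum_a \sum_(h : k.-tuple (state n * action m))
    reach_prob Pi s h u * decision_prob h u a * transition I a (Some t)).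
  by rewrite [RHS]pair_bigA; apply: eq_bigr => -[].
(* The target admits only the action [None], which never leads back to a state [Some t]. *)
rewrite sum_option /= [X in X + _](_ : _ = 0) ?add0r; last first.
  rewrite sum_option /= [X in _ + X]big1 ?addr0; last first.
    by move=> a _; rewrite big1 // => h _; rewrite /decision_prob /= mulr0 mul0r.
  by rewrite big1 // => h _; rewrite mulr0.
apply: eq_bigr => u _; case pu: (pi u) => [b|]; last first.
  rewrite occupation_closed // mul0r.
  rewrite big1 // => a _; rewrite -mulr_suml -mulr_suml IHk.
  by rewrite occupation_closed // !mul0r.
rewrite (bigD1 (Some b)) //= [X in _ + X]big1 ?addr0.
  by rewrite -!mulr_suml IHk /decision_prob /= ffunE pu /= eqxx mulr1 mxE pu.
move=> a ab; rewrite big1 // => h _; rewrite /decision_prob /= ffunE pu /=.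
by rewrite (inj_eq Some_inj) eq_sym (negbTE ab) mulr0 mul0r.
Qed.

Lemma action_probE k a :
  action_prob Pi s k a 0 = \sum_(t | pi t == Some a) occupation k 0 t.
Proof.
rewrite mxE exchange_big sum_option /= [X in X + _]big1 ?add0r; last first.
  by move=> h _; rewrite /decision_prob mulr0.
rewrite [RHS]big_mkcond; apply: eq_bigr => t _.
rewrite -mulr_suml reach_prob_sum /decision_prob /= ffunE.
case pit: (pi t) => [b|]; last by rewrite occupation_closed // mul0r.
by rewrite /= !(inj_eq Some_inj); case: eqP; rewrite ?mulr1 ?mulr0.
Qed.

(** The geometric sum telescopes against [1 - A], whose inverse is [N]. *)
Lemma occupation_sum K t :
  \sum_(k < K) occupation k 0 t = N s t - (occupation K *m N) 0 t.
Proof.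
have : (\sum_(k < K) occupation k) *m (1%:M - A) = delta_mx 0 s - occupation K.
  elim: K => [|K IHK]; first by rewrite big_ord0 mul0mx subrr.
  by rewrite big_ord_recr mulmxDl IHK mulmxBr mulmx1 addrA subrK.
case: trN => /mulmx1C NP _ _ /(congr1 (mulmxr N)) /=.
rewrite -mulmxA NP mulmx1 mulmxBl => /rowP/(_ t).
by rewrite summxE mxE -rowE !mxE => ->.
Qed.

Lemma occupation_sum_le K t : \sum_(k < K) occupation k 0 t <= N s t.
Proof.
rewrite occupation_sum lerBlDr lerDl mxE sumr_ge0 // => u _.
by case: trN => _ N0 _; rewrite mulr_ge0 // occupation_ge0.
Qed.

Lemma occupation_series t :
  series (fun k => occupation k 0 t) = (fun K => \sum_(k < K) occupation k 0 t).
Proof. by apply/funext => K; rewrite /series /= big_mkord. Qed.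

(** Partial sums bounded by [N s t] force the terms to 0; this in turn makes the remainder in
    [occupation_sum] vanish. *)
Lemma occupation_cvg0 t : (occupation k 0 t @[k --> \oo] --> (0 : R))%classic.
Proof.
apply: cvg_series_cvg_0; apply: nondecreasing_is_cvgn.
  by apply: nondecreasing_series => k _ _; apply: occupation_ge0.
exists (N s t) => _ [K _ <-]; rewrite occupation_series; exact: occupation_sum_le.
Qed.

Lemma occupation_cvg t :
  (\sum_(k < K) occupation k 0 t @[K --> \oo] --> N s t)%classic.
Proof.
have -> : (fun K => \sum_(k < K) occupation k 0 t) =
    (fun K => N s t - \sum_u occupation K 0 u * N u t).
  by apply/funext => K; rewrite occupation_sum mxE.
rewrite -[X in (_ --> X)%classic]subr0; apply: cvgB; first exact: cvg_cst.
have := @cvgn_sum R _ xpredT (fun u K => occupation K 0 u * N u t) (fun=> 0).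
have -> : \sum_(u : 'I_n) (0 : R) = 0 by rewrite big1.
apply=> u _; rewrite -(mul0r (N u t)); apply: cvgM (cvg_cst _); apply: occupation_cvg0.
Qed.

Lemma flux_series_cvg a :
  (flux_series Pi s a @ \oo --> policy_flux pi N s a 0)%classic.
Proof.
rewrite mxE.
have -> : flux_series Pi s a =
    (fun K => \sum_(t | pi t == Some a) \sum_(k < K) occupation k 0 t).
  apply/funext => K; rewrite /flux_series /series /= big_mkord exchange_big /=.
  by apply: eq_bigr => k _; rewrite action_probE.
apply: cvgn_sum => t _.
exact: occupation_cvg.
Qed.

Lemma stationary_policy_proper : proper_policy Pi s.
Proof. by move=> a; apply/cvg_ex; exists (policy_flux pi N s a 0); apply: flux_series_cvg. Qed.

Lemma stationary_policy_flux : flux Pi s = policy_flux pi N s.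
Proof.
apply/colP => a; rewrite [LHS]mxE; apply: cvg_lim; first exact: Rhausdorff.
exact: flux_series_cvg.
Qed.

End Flux.

End StationaryPolicy.

(** * Binary size *)

Section BinarySize.
Variable R : realType.
Implicit Types (u v : R) (E F : nat).

(** The fraction need not be in lowest terms, so the exponents simply add up under arithmetic
    operations. *)
Definition small E v : Prop := exists d : nat,
  [/\ (0 < d <= 2 ^ E)%N, v * d%:R \is a Num.int & `|v * d%:R| <= (2 ^ E)%:R].

(** Reduction only shrinks numerator and denominator, which take at most [E + 1] each in [rat_size];
    the last unit is the 1 in its definition. *)
Lemma small_rat E v : small E v ->
  exists2 r : rat, v = ratr r & (rat_size r <= 2 * E + 3)%N.
Proof.
case=> d [/andP[d0 dE] /intrP[z zE]]; rewrite zE -intr_norm -[(2 ^ E)%:R]/((2 ^ E)%:Z%:~R).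
rewrite ler_int => zb; exists (z%:~R / d%:Z%:~R).
  by rewrite fmorph_div /= !ratr_int -zE mulfK // pnatr_eq0 -lt0n.
have bnd k : (k <= 2 ^ E)%N -> (up_log 2 k.+1 <= E.+1)%N.
  move=> kE; apply: up_log_min => //; rewrite expnS mul2n -addnn -addn1.
  by rewrite leq_add // expn_gt0.
have d0Z : d%:Z != 0 by rewrite eqz_nat -lt0n.
have [k k0 [zk dk]] : exists2 k : int, k != 0 &
   z = k * numq (z%:~R / d%:Z%:~R) /\ d%:Z = k * denq (z%:~R / d%:Z%:~R).
  by case: divqP d0Z => // k y k0 _; exists k.
have le k1 k2 : k1 = k * k2 -> (`|k2| <= `|k1|)%N.
  by move=> ->; rewrite abszM leq_pmull // absz_gt0.
rewrite /rat_size; have := bnd `|numq (z%:~R / d%:Z%:~R)|%N.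
have := bnd `|denq (z%:~R / d%:Z%:~R)|%N; have := le _ _ zk; have := le _ _ dk.
move: zb; rewrite -[`|z|]/(`|z|%:Z) lez_nat /=; lia.
Qed.

Lemma small_nat_frac E v d : (0 < d <= 2 ^ E)%N -> v * d%:R \is a Num.int ->
  `|v| <= 1 -> small E v.
Proof.
move=> dE di v1; exists d; split=> //; rewrite normrM normr_nat.
by case/andP: dE => _; rewrite -(ler_nat R); apply: le_trans; rewrite ler_piMl.
Qed.

Lemma small0 E : small E 0.
Proof. by exists 1%N; rewrite expn_gt0 mul0r rpred0 normr0 ler0n. Qed.

Lemma small1 E : small E 1.
Proof. by exists 1%N; rewrite expn_gt0 mul1r rpred1 normr1 ler1n expn_gt0. Qed.

Lemma smallN E v : small E v -> small E (- v).
Proof. by case=> d [dE di db]; exists d; rewrite mulNr rpredN normrN. Qed.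

Lemma smallD E F u v : small E u -> small F v -> small (E + F).+1 (u + v).
Proof.
move=> [d [/andP[d0 dE] di db]] [e [/andP[e0 eF] ei eb]]; exists (d * e)%N.
have -> : (u + v) * (d * e)%:R = u * d%:R * e%:R + v * e%:R * d%:R.
  by rewrite natrM; ring.
rewrite muln_gt0 d0 e0 /= expnS expnD; split.
- by rewrite -[leqLHS]mul1n; apply: leq_mul => //; apply: leq_mul.
- by rewrite rpredD // rpredM // natr_int.
- apply: le_trans (ler_normD _ _) _; rewrite (normrM (u * _)) (normrM (v * _)) !normr_nat mul2n -addnn natrD.
  rewrite !natrM; apply: lerD; first by apply: ler_pM; rewrite // ler_nat.
  by rewrite [leRHS]mulrC; apply: ler_pM; rewrite // ler_nat.
Qed.

Lemma smallB E F u v : small E u -> small F v -> small (E + F).+1 (u - v).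
Proof. by move=> su /smallN; apply: smallD. Qed.

Lemma smallM E F u v : small E u -> small F v -> small (E + F) (u * v).
Proof.
move=> [d [/andP[d0 dE] di db]] [e [/andP[e0 eF] ei eb]]; exists (d * e)%N.
have -> : (u * v) * (d * e)%:R = u * d%:R * (v * e%:R) by rewrite natrM; ring.
rewrite muln_gt0 d0 e0 /= expnD; split.
- exact: leq_mul.
- exact: rpredM.
- by rewrite normrM natrM; apply: ler_pM.
Qed.

Lemma small_div E F u v : small E u -> small F v -> small (E + F) (u / v).
Proof.
move=> su [e [/andP[e0 eF] ei eb]].
have [->|v0] := eqVneq v 0; first by rewrite invr0 mulr0; apply: small0.
apply: smallM => //; case/intrP: ei => z zE.
have z0 : z != 0.
  by rewrite -(intr_eq0 R) -zE mulf_neq0 // pnatr_eq0 -lt0n.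
have zR : (`|z|%N)%:R = `|v * e%:R| by rewrite zE -intr_norm.
(* The numerator of [v], made positive, is the denominator of its inverse; the sign moves to the
   numerator. *)
exists `|z|%N; rewrite absz_gt0 z0 /=.
have E1 : `|v^-1 * (`|z|%N)%:R| = e%:R.
  by rewrite zR normrM normr_id !normrM normr_nat mulrA -normrM mulVf // normr1 mul1r.
split; rewrite ?E1 ?ler_nat //; first by rewrite -(ler_nat R) zR.
rewrite zR normrM normr_nat mulrA.
case: (ler0P v) => _; last by rewrite mulVf // mul1r natr_int.
by rewrite mulrN mulVf // mulN1r rpredN natr_int.
Qed.

Section InputDenominator.
Variable rats : seq rat.

Definition input_size : nat := (\sum_(r <- rats) rat_size r)%N.
(** The plain product already satisfies the size bound, so no least common multiple is taken. *)
Definition input_denom : nat := (\prod_(r <- rats) `|denq r|)%N.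

Lemma input_denom_gt0 : (0 < input_denom)%N.
Proof. by apply: prodn_gt0 => r; rewrite absz_gt0 denq_neq0. Qed.

Lemma lt_up_log k : (k < 2 ^ up_log 2 k.+1)%N.
Proof. exact: up_logP. Qed.

Lemma input_denom_le : (input_denom <= 2 ^ input_size)%N.
Proof.
rewrite /input_denom /input_size; elim: rats => [|r l IH]; rewrite ?big_nil // !big_cons.
rewrite expnD leq_mul //; apply: ltnW; apply: leq_trans (lt_up_log _) _.
by rewrite leq_exp2l // /rat_size leq_addl.
Qed.

Lemma rat_size_le r : r \in rats -> (rat_size r <= input_size)%N.
Proof. by move=> rr; rewrite /input_size (big_rem r) //= leq_addr. Qed.

Lemma input_int r : r \in rats -> (ratr r : R) * input_denom%:R \is a Num.int.
Proof.
move=> rr; rewrite /input_denom (big_rem r) //= natrM mulrA rpredM ?natr_int //.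
have -> : (`|denq r|%N)%:R = (denq r)%:~R :> R by rewrite -[in RHS]absz_denq.
by rewrite /ratr mulfVK ?intr_int // intr_eq0 denq_neq0.
Qed.

Lemma input_le r : r \in rats -> `|ratr r : R| <= (2 ^ input_size)%:R.
Proof.
move=> rr; rewrite /ratr normrM normfV -!intr_norm.
apply: (@le_trans _ _ (`|numq r|)%:~R).
  rewrite ler_piMr ?ler0z // invf_le1 ?ltr0z ?normr_gt0 ?denq_neq0 //.
  by rewrite ler1z -gtz0_ge1 normr_gt0 denq_neq0.
rewrite -[(2 ^ _)%:R]/((2 ^ input_size)%:Z%:~R) ler_int.
rewrite -[`|numq r|]/(`|numq r|%:Z) lez_nat; apply: ltnW.
apply: leq_trans (lt_up_log _) _; rewrite leq_exp2l //.
apply: leq_trans (rat_size_le rr); rewrite /rat_size; lia.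
Qed.

Lemma input_size_ge : (size rats <= input_size)%N.
Proof.
rewrite /input_size -sum1_size; apply: leq_sum => r _.
by rewrite /rat_size -addnA.
Qed.

End InputDenominator.

Lemma det_int k (A : 'M[R]_k) : (forall i j, A i j \is a Num.int) ->
  \det A \is a Num.int.
Proof.
move=> Ai; apply: rpred_sum => p _; apply: rpredM; first by rewrite rpredX // rpredN1.
by apply: rpred_prod => i _.
Qed.

Lemma det_le k (A : 'M[R]_k) B : (forall i j, `|A i j| <= B) ->
  `|\det A| <= (k`!)%:R * B ^+ k.
Proof.
move=> AB; apply: le_trans (ler_norm_sum _ _ _) _.
rewrite -card_Sn -sum1_card natr_sum mulr_suml.
apply: ler_sum => p _; rewrite mul1r normrM normrX normrN1 expr1n mul1r normr_prod.
by rewrite -[in leRHS](card_ord k) -prodr_const; apply: ler_prod => i _; rewrite normr_ge0 AB.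
Qed.

(* Cramer's rule: the entries of the inverse of [M] have the common
   denominator [det (D M)]. *)
Lemma inverse_denom k (N M : 'M[R]_k) (D E : nat) :
  N *m M = 1%:M -> (0 < D <= 2 ^ E)%N ->
  (forall i j, M i j * D%:R \is a Num.int) -> (forall i j, `|M i j| <= 1) ->
  exists d : nat, [/\ (0 < d <= 2 ^ (k * k + k * E))%N,
    forall i j, N i j * d%:R \is a Num.int
  & forall i j, `|N i j * d%:R| <= (2 ^ (k * k + k * E))%:R].
Proof.
move=> NM /andP[D0 DE] Mi M1; set Z := D%:R *: M.
have DR0 : D%:R != 0 :> R by rewrite pnatr_eq0 -lt0n.
have Zi i j : Z i j \is a Num.int by rewrite mxE mulrC.
have Zb i j : `|Z i j| <= D%:R by rewrite mxE normrM normr_nat ler_piMr.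
(* The exponent collects [j! <= 2 ^ (j * j)], for the number of terms of a determinant, and
   [D ^ j <= 2 ^ (j * E)], for their size. *)
have DkE j : (j <= k)%N -> (j`! * D ^ j <= 2 ^ (k * k + k * E))%N.
  move=> jk; rewrite expnD; apply: leq_mul.
    apply: (@leq_trans (2 ^ (j * j))); last by rewrite leq_exp2l // leq_mul.
    elim: j {jk} => // j IHj; rewrite factS.
    apply: (@leq_trans (2 ^ j.+1 * 2 ^ (j * j))).
      by apply: leq_mul => //; apply: ltnW; apply: ltn_expl.
    by rewrite -expnD leq_exp2l //; lia.
  apply: (@leq_trans ((2 ^ E) ^ j)); last by rewrite -expnM leq_exp2l // mulnC leq_mul.
  by case: j jk => // j _; rewrite leq_exp2r.
have /intrP[z zE] := det_int Zi.
have NZ : N *m Z = D%:R%:M by rewrite -scalemxAr NM -[D%:R%:M]scalemx1.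
have Nadj i j : N i j * \det Z = D%:R * \adj Z i j.
  have := congr1 (mulmxr (\adj Z)) NZ; rewrite /= -mulmxA mul_mx_adj.
  rewrite mul_mx_scalar mul_scalar_mx => /matrixP/(_ i j).
  by rewrite !mxE mulrC.
have detZ : \det Z != 0.
  apply/negP => /eqP Z0; have := congr1 determinant NZ.
  rewrite det_mulmx Z0 mulr0 det_scalar => /esym/eqP.
  by rewrite expf_eq0 (negbTE DR0) andbF.
have z0 : z != 0 by rewrite -(intr_eq0 R) -zE.
have zR : (`|z|%N)%:R = `|\det Z| by rewrite zE -intr_norm.
exists `|z|%N; rewrite absz_gt0 z0 /=; split.
- rewrite -(ler_nat R) zR; apply: le_trans (det_le Zb) _.
  by rewrite -natrX -natrM ler_nat DkE.
- move=> i j; rewrite zR; have : D%:R * \adj Z i j \is a Num.int.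
    rewrite rpredM ?natr_int // mxE /cofactor rpredM //.
      by rewrite rpredX // rpredN1.
    by apply: det_int => p q; rewrite !mxE mulrC.
  by rewrite -Nadj; case: (ler0P (\det Z)) => // _ h; rewrite mulrN rpredN.
- move=> i j; rewrite zR normrM normr_id -normrM Nadj normrM normr_nat.
  (* The cofactors are determinants of size one less, hence the case split; the extra factor [D]
     restores the full power. *)
  case: k N M NM Mi M1 Z Zi Zb DkE z zE NZ Nadj detZ z0 zR i j =>
    [|k] N M NM Mi M1 Z Zi Zb DkE z zE NZ Nadj detZ z0 zR i j; first by case: i.
  have : `|\adj Z i j| <= (k`!)%:R * D%:R ^+ k.
    rewrite mxE /cofactor normrM normrX normrN1 expr1n mul1r.
    by apply: det_le => p q; rewrite mxE mxE Zb.
  move=> h; apply: le_trans (_ : (k.+1`! * D ^ k.+1)%:R <= _); last by rewrite ler_nat DkE.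
  rewrite natrM natrX exprS mulrCA ler_wpM2l ?ler0n //.
  apply: le_trans h _; rewrite ler_wpM2r ?exprn_ge0 // ler_nat factS leq_pmull //.
Qed.

End BinarySize.

(** * Bit sizes of all the numbers that the program stores *)

Section Sizes.
Variables (R : realType) (n m : nat) (I : ssp R n m) (s : 'I_n) (x : 'cV[R]_m).
Implicit Types (pi : {ffun 'I_n -> option 'I_m}) (N : 'M[R]_n) (y : 'cV[R]_m).
Implicit Types (t u : 'I_n) (a : 'I_m) (i : nat).

Local Notation P := (ssp_P I).
Local Notation J := (ssp_J I).

(** With the dimensions at most [L], an inverse has exponent at most [2 * L ^ 2]. The cubic term is
    for the flow, whose denominator gains such a factor in each of at most [L] rounds; the rest
    leaves room for sums, products and quotients of these numbers. *)
Definition size_bound (L : nat) : nat := (2 * L ^ 3 + 8 * L ^ 2 + 6 * L + 1)%N.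

(** The predicate imposed on every write. It is vacuous when some input number is irrational, so one
    proof serves both clauses of strong polynomiality. *)
Definition good_value (v : R) : Prop :=
  forall rats : seq rat, input_numbers I s x = [seq ratr r | r <- rats] ->
  exists2 r : rat, v = ratr r & (rat_size r <= 2 * size_bound (input_size rats) + 3)%N.

Lemma good_value_small v :
  (forall rats : seq rat, input_numbers I s x = [seq ratr r | r <- rats] ->
    exists2 E, small E v & (E <= size_bound (input_size rats))%N) ->
  good_value v.
Proof.
move=> sv rats numsE; have [E sE Eb] := sv _ numsE.
have [r vr rs] := small_rat sE; exists r => //; apply: leq_trans rs _.
by rewrite leq_add2r leq_mul2l.
Qed.

Lemma mx_entries_mem p q (A : 'M[R]_(p, q)) k l : A k l \in mx_entries A.
Proof. by apply: allpairs_f; rewrite mem_enum. Qed.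

Lemma size_input_numbers : size (input_numbers I s x) = (3 + 2 * (m * n) + 2 * m)%N.
Proof.
rewrite /input_numbers !size_cat /= !size_allpairs !size_enum_ord; lia.
Qed.

Section Rational.
Variable rats : seq rat.
Hypothesis numsE : input_numbers I s x = [seq ratr r | r <- rats].

Let L := input_size rats.
Let D := input_denom rats.
Let E1 := (n * n + n * L)%N.

Lemma input_value v : v \in input_numbers I s x ->
  v * D%:R \is a Num.int /\ `|v| <= (2 ^ L)%:R.
Proof.
by rewrite numsE => /mapP[r rr ->]; split; [apply: input_int|apply: input_le].
Qed.

Lemma denom_bounds : (0 < D <= 2 ^ L)%N.
Proof. by rewrite input_denom_gt0 input_denom_le. Qed.

Lemma P_int a u : P a u * D%:R \is a Num.int.
Proof.
by have [] := @input_value (P a u); rewrite // !mem_cat mx_entries_mem !orbT.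
Qed.

Lemma x_int a : x a 0 * D%:R \is a Num.int.
Proof.
by have [] := @input_value (x a 0); rewrite // !mem_cat mx_entries_mem !orbT.
Qed.

Lemma x_le a : `|x a 0| <= (2 ^ L)%:R.
Proof.
by have [] := @input_value (x a 0); rewrite // !mem_cat mx_entries_mem !orbT.
Qed.

(** The input has at least [m * n] numbers, each of size at least 1, and [m] is positive because of
    [a]. *)
Lemma dim_le (a : 'I_m) : (n <= L)%N /\ (m <= L)%N.
Proof.
have := input_size_ge rats; rewrite -(size_map (@ratr R)) -numsE size_input_numbers.
have : (0 < m)%N by case: a => i; apply: leq_ltn_trans.
rewrite -/L; nia.
Qed.

Lemma P_le1 a u : P a u <= 1.
Proof.
apply: le_trans (ssp_P_le1 I a); rewrite (bigD1 u) //= lerDl.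
by apply: sumr_ge0 => v _; apply: ssp_P_ge0.
Qed.

Lemma small_P a u : small L (P a u).
Proof.
apply: (small_nat_frac denom_bounds (P_int a u)).
by rewrite ger0_norm ?P_le1 // ssp_P_ge0.
Qed.

Lemma small_leak a (B : pred 'I_n) : small L (1 - \sum_(u | B u) P a u).
Proof.
apply: (small_nat_frac denom_bounds).
  rewrite mulrBl mul1r rpredB ?natr_int // mulr_suml rpred_sum // => u _.
  exact: P_int.
have B0 : 0 <= \sum_(u | B u) P a u by apply: sumr_ge0 => u _; apply: ssp_P_ge0.
have B1 : \sum_(u | B u) P a u <= 1.
  apply: le_trans (ssp_P_le1 I a); rewrite [leRHS](bigID B) /= lerDl.
  by apply: sumr_ge0 => u _; apply: ssp_P_ge0.
by rewrite ger0_norm; lra.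
Qed.

Lemma transient_denom pi N : transient I pi N ->
  exists d : nat, [/\ (0 < d <= 2 ^ E1)%N,
    forall t u, N t u * d%:R \is a Num.int
  & forall t u, `|N t u * d%:R| <= (2 ^ E1)%:R].
Proof.
case=> NP _ _; apply: (inverse_denom NP denom_bounds) => t u; rewrite !mxE.
  rewrite mulrBl rpredB //; first by rewrite rpredM ?natr_int.
  by case: (pi t) => [a|]; [apply: P_int|rewrite mul0r rpred0].
have : 0 <= (if pi t is Some a then P a u else 0) <= 1.
  by case: (pi t) => [a|]; rewrite ?ssp_P_ge0 ?P_le1 ?lexx ?ler01.
move: (if pi t is Some a then P a u else 0) => p /andP[p0 p1].
by case: eqP => _ /=; rewrite ler_norml; apply/andP; split; lra.
Qed.

Lemma small_N pi N t u : transient I pi N -> small E1 (N t u).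
Proof. by case/transient_denom => d [db di dn]; exists d. Qed.

(** All terms share the denominator [D * d], so summation costs only the [n] in the exponent, for
    the number of terms. The predicate [B] covers the partial sums stored by the loop. *)
Lemma small_pivot_row pi N a (B : pred 'I_n) u : transient I pi N ->
  small (n + L + E1) (\sum_(t | B t) P a t * N t u).
Proof.
case/transient_denom => d [/andP[d0 db] di dn]; exists (D * d)%N.
have /andP[D0 Db] := denom_bounds.
have E : (\sum_(t | B t) P a t * N t u) * (D * d)%:R =
    \sum_(t | B t) (P a t * D%:R) * (N t u * d%:R).
  by rewrite mulr_suml; apply: eq_bigr => t _; rewrite natrM; ring.
rewrite muln_gt0 D0 d0 E; split.
- rewrite -addnA addnC expnD -[(D * d)%N]muln1; apply: leq_mul; last by rewrite expn_gt0.
  by rewrite expnD leq_mul.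
- by apply: rpred_sum => t _; rewrite rpredM // P_int.
- apply: le_trans (ler_norm_sum _ _ _) _.
  apply: (@le_trans _ _ (\sum_(t < n) (2 ^ (L + E1))%:R)).
    rewrite [leRHS](bigID B) /= -[leLHS]addr0; apply: lerD; last first.
      by apply: sumr_ge0 => t _; rewrite ler0n.
    apply: ler_sum => t _; rewrite normrM expnD natrM; apply: ler_pM => //.
    rewrite normrM normr_nat ger0_norm ?ssp_P_ge0 //.
    apply: (@le_trans _ _ (D%:R)); last by rewrite ler_nat.
    by rewrite ler_piMl ?P_le1 // ler0n.
  rewrite sumr_const card_ord -[leLHS]mulr_natr -natrM ler_nat -addnA [leqRHS]expnD mulnC.
  by rewrite leq_mul2r ltnW ?orbT // ltn_expl.
Qed.

Definition common_denom i y : Prop := exists2 d : nat,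
  (0 < d <= 2 ^ (L + i * E1))%N & forall a, y a 0 * d%:R \is a Num.int.

Lemma common_denom0 : common_denom 0 x.
Proof. by exists D; rewrite ?addn0 ?denom_bounds //; apply: x_int. Qed.

(** With [N s t = z / d], the denominators [d] of [N s t] and of the flux cancel, so [e] is
    multiplied by the absolute value of [z] only. *)
Lemma common_denomS i y pi N t a : common_denom i y -> transient I pi N ->
  0 < N s t ->
  common_denom i.+1 (y - (y a 0 / N s t) *: policy_flux pi N s).
Proof.
move=> [e /andP[e0 eb] ei] trN Nt.
have [d [/andP[d0 db] di dn]] := transient_denom trN.
have /intrP[z zE] := di s t.
have Nd : 0 < N s t * d%:R by rewrite mulr_gt0 // ltr0n.
have zN : (`|z|%N)%:R = N s t * d%:R.
  by rewrite -[RHS]gtr0_norm // zE -intr_norm.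
have fd b : policy_flux pi N s b 0 * d%:R \is a Num.int.
  by rewrite mxE mulr_suml rpred_sum.
exists (e * `|z|)%N.
  rewrite muln_gt0 e0 -(ltr_nat R) zN Nd /= mulSn addnCA addnC expnD leq_mul //.
  by rewrite -(ler_nat R) zN -[leLHS]gtr0_norm.
move=> b; have -> : (y - (y a 0 / N s t) *: policy_flux pi N s) b 0 * (e * `|z|)%:R =
    y b 0 * e%:R * (`|z|%N)%:R - (y a 0 * e%:R) * (policy_flux pi N s b 0 * d%:R).
  rewrite natrM zN [X in X * _]mxE [in X in _ + X]mxE [in X in _ + X]mxE.
  by field; rewrite gt_eqF.
by apply: rpredB; apply: rpredM => //; apply: natr_int.
Qed.

(** The values stay below those of [x], so a bound on the denominator bounds the numerator too. *)
Lemma small_flow i y a : common_denom i y -> 0 <= y a 0 <= x a 0 -> (i <= m)%N ->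
  small (2 * L + L * E1) (y a 0).
Proof.
move=> [e /andP[e0 eb] ei] /andP[y0 yx] im; exists e; have [nL mL] := dim_le a.
have eL : (2 ^ (L + i * E1) <= 2 ^ (L + L * E1))%N.
  by rewrite leq_exp2l // leq_add2l leq_mul2r (leq_trans im) ?orbT.
have eb' := leq_trans eb eL.
have eb2 : (2 ^ (2 * L + L * E1) = 2 ^ L * 2 ^ (L + L * E1))%N.
  by rewrite -expnD mul2n -addnn addnA.
rewrite e0 eb2; split=> //.
  by rewrite -[e]mul1n leq_mul // expn_gt0.
rewrite normrM normr_nat natrM; apply: ler_pM; rewrite ?ler_nat ?normr_ge0 //.
rewrite ger0_norm //; apply: le_trans yx _; apply: le_trans (x_le a); exact: ler_norm.
Qed.

(** The balance equation at [s] has coefficients of denominator [D], so [D * e] serves for [mu]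
    whatever subtractions led to it. *)
Lemma small_mass i y mu : common_denom i y -> balance I y = mu *: delta_mx s 0 ->
  0 <= mu <= 1 -> (0 < m)%N -> (i <= m)%N -> small (2 * L + L * E1) mu.
Proof.
move=> [e /andP[e0 eb] ei] /colP/(_ s) + /andP[mu0 mu1] m0 im.
rewrite balanceE !mxE !eqxx mulr1 => muE.
have /andP[D0 Db] := denom_bounds.
apply: (@small_nat_frac _ _ _ (D * e)%N); last by rewrite ger0_norm.
  rewrite muln_gt0 D0 e0 /= mul2n -addnn -addnA expnD leq_mul //.
  apply: leq_trans eb _; rewrite leq_exp2l // leq_add2l leq_mul2r.
  by have [_ mL] := dim_le (Ordinal m0); rewrite (leq_trans im) ?orbT.
rewrite -muE natrM mulrBl; apply: rpredB; rewrite mulr_suml; apply: rpred_sum => a _.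
  have -> : (J a s)%:R * y a 0 * (D%:R * e%:R) = (J a s)%:R * D%:R * (y a 0 * e%:R) :> R.
    by ring.
  by apply: rpredM => //; apply: rpredM; apply: natr_int.
have -> : P a s * y a 0 * (D%:R * e%:R) = (P a s * D%:R) * (y a 0 * e%:R) by ring.
by rewrite rpredM // P_int.
Qed.

End Rational.

Definition tame i y : Prop :=
  [/\ (i <= m)%N, forall a, 0 <= y a 0 <= x a 0 & forall rats,
   input_numbers I s x = [seq ratr r | r <- rats] -> common_denom rats i y].

Lemma good_value0 : good_value 0.
Proof. by apply: good_value_small => rats _; exists 0%N => //; apply: small0. Qed.

Lemma good_value1 : good_value 1.
Proof. by apply: good_value_small => rats _; exists 0%N => //; apply: small1. Qed.

Ltac size_le a numsE := have [] := dim_le numsE a; rewrite /size_bound; set L := input_size _; nia.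

Lemma good_leak a (B : pred 'I_n) : good_value (1 - \sum_(u | B u) P a u).
Proof.
apply: good_value_small => rats numsE; eexists; first exact: (small_leak numsE).
size_le a numsE.
Qed.

Section Transient.
Variables (pi : {ffun 'I_n -> option 'I_m}) (N : 'M[R]_n).
Hypothesis trN : transient I pi N.

(* The argument [a] witnesses [0 < m], without which [n] is not bounded by the
   size of the input. *)
Lemma good_N a t u : good_value (N t u).
Proof.
apply: good_value_small => rats numsE; eexists; first exact: (small_N numsE _ _ trN).
size_le a numsE.
Qed.

Lemma good_PN a t u : good_value (P a t * N t u).
Proof.
apply: good_value_small => rats numsE; eexists.
  exact: smallM (small_P numsE a t) (small_N numsE _ _ trN).
size_le a numsE.
Qed.

Lemma good_pivot_row a (B : pred 'I_n) u :
  good_value (\sum_(t | B t) P a t * N t u).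
Proof.
apply: good_value_small => rats numsE; eexists.
  exact: (small_pivot_row numsE a B u trN).
size_le a numsE.
Qed.

Lemma pivot_rowE a u : pivot_row I N a 0 u = \sum_t P a t * N t u.
Proof. by rewrite mxE; apply: eq_bigr => t _; rewrite mxE. Qed.

Lemma good_pivot a t : good_value (1 - pivot_row I N a 0 t).
Proof.
apply: good_value_small => rats numsE; eexists; rewrite ?pivot_rowE.
  exact: smallB (small1 _ 0) (small_pivot_row numsE a xpredT t trN).
size_le a numsE.
Qed.

Lemma good_factor a t u : good_value (N u t / (1 - pivot_row I N a 0 t)).
Proof.
apply: good_value_small => rats numsE; eexists; rewrite ?pivot_rowE.
  apply: small_div (small_N numsE _ _ trN) _.
  exact: smallB (small1 _ 0) (small_pivot_row numsE a xpredT t trN).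
size_le a numsE.
Qed.

Lemma good_update a t u v :
  good_value (N u t / (1 - pivot_row I N a 0 t) * pivot_row I N a 0 v).
Proof.
apply: good_value_small => rats numsE; eexists; rewrite ?pivot_rowE.
  apply: smallM (small_pivot_row numsE a xpredT v trN).
  apply: small_div (small_N numsE _ _ trN) _.
  exact: smallB (small1 _ 0) (small_pivot_row numsE a xpredT t trN).
size_le a numsE.
Qed.

Lemma good_ratio i y a t : tame i y -> good_value (y a 0 / N s t).
Proof.
move=> [im y0x cd]; apply: good_value_small => rats numsE; eexists.
  exact: small_div (small_flow numsE (cd _ numsE) (y0x a) im) (small_N numsE _ _ trN).
size_le a numsE.
Qed.

Lemma good_decrement i y a t u : tame i y -> good_value (y a 0 / N s t * N s u).
Proof.
move=> [im y0x cd]; apply: good_value_small => rats numsE; eexists.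
  apply: smallM (small_N numsE _ _ trN).
  exact: small_div (small_flow numsE (cd _ numsE) (y0x a) im) (small_N numsE _ _ trN).
size_le a numsE.
Qed.

End Transient.

Lemma good_flow i y a : tame i y -> good_value (y a 0).
Proof.
move=> [im y0x cd]; apply: good_value_small => rats numsE; eexists.
  exact: (small_flow numsE (cd _ numsE) (y0x a) im).
size_le a numsE.
Qed.

Lemma good_mass i y mu : tame i y -> (0 < m)%N ->
  balance I y = mu *: delta_mx s 0 -> 0 <= mu <= 1 -> good_value mu.
Proof.
move=> [im y0x cd] m0 bal mu01; apply: good_value_small => rats numsE; eexists.
  exact: (small_mass numsE (cd _ numsE) bal mu01 m0 im).
size_le (Ordinal m0) numsE.
Qed.

End Sizes.

(** * The program *)

Section Rules.
Variables (R : realType) (G : R -> Prop).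
Implicit Types (st : store R) (Q : store R -> Prop).

Definition rset st (a i j : nat) (r : R) : store R :=
  Store (nmem st)
    (fun a' i' j' => if [&& a' == a, i' == i & j' == j] then r else rmem st a' i' j').

Lemma wp_seq c d Q st : wp G c (wp G d Q) st -> wp G (FSeq c d) Q st.
Proof. by []. Qed.

Lemma wp_if b c d Q st : (teval st b -> wp G c Q st) -> (~~ teval st b -> wp G d Q st) ->
  wp G (FIf b c d) Q st.
Proof. by move=> t f /=; case: ifPn. Qed.

Lemma wp_nat a i e j v Q st : neval st i = j -> neval st e = v ->
  Q (nwrite st a j v) -> wp G (FNat a i e) Q st.
Proof. by move=> <- <-. Qed.

Lemma wp_const a i j k i' j' Q st : neval st i = i' -> neval st j = j' ->
  G k%:R -> Q (rset st a i' j' k%:R) -> wp G (FConst (RLoc a i j) k) Q st.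
Proof. by move=> <- <- Gk Qst; split. Qed.

Lemma wp_copy a i j u i' j' r Q st : neval st i = i' -> neval st j = j' ->
  rread st u = r -> G r -> Q (rset st a i' j' r) -> wp G (FCopy (RLoc a i j) u) Q st.
Proof. by move=> <- <- <- Gr Qst; split. Qed.

Lemma wp_op o a i j u v i' j' r Q st : neval st i = i' -> neval st j = j' ->
  rop_eval o (rread st u) (rread st v) = r ->
  G r -> Q (rset st a i' j' r) -> wp G (FOp o (RLoc a i j) u v) Q st.
Proof. by move=> <- <- <- Gr Qst; split. Qed.

Lemma wp_conseq c Q Q' st : wp G c Q st ->
  (forall st', frame c st st' -> Q st' -> Q' st') -> wp G c Q' st.
Proof. by move=> /wp_frame w QQ'; apply: wp_mono w => st' [? ?]; apply: QQ'. Qed.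

End Rules.

Arguments wp : simpl never.

(** The step of the invariant of an accumulating loop: the cell holds the sum over the indices below
    the counter. *)
Lemma sum_ltS (R : nmodType) n (i : 'I_n) (B : pred 'I_n) (F : 'I_n -> R) :
  \sum_(u < n | (u < i.+1)%N && B u) F u =
  \sum_(u < n | (u < i)%N && B u) F u + (if B i then F i else 0).
Proof.
case: ifPn => Bi.
  rewrite (bigD1 i) ?ltnS ?leqnn //= addrC; congr (_ + _); apply: eq_bigl => u.
  by rewrite ltnS ltn_neqAle -val_eqE /= andbC andbA.
rewrite addr0; apply: eq_bigl => u; rewrite ltnS leq_eqVlt.
by case: (u =P i :> nat) => //= /val_inj ->; rewrite (negbTE Bi) andbF.
Qed.

Lemma sum_lt0 (R : nmodType) n (B : pred 'I_n) (F : 'I_n -> R) :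
  \sum_(u < n | (u < 0)%N && B u) F u = 0.
Proof. exact: big_pred0. Qed.

Lemma sum_ltT (R : nmodType) n (B : pred 'I_n) (F : 'I_n -> R) :
  \sum_(u < n | (u < n)%N && B u) F u = \sum_(u | B u) F u.
Proof. by apply: eq_bigl => u; rewrite ltn_ord. Qed.

(* Natural arrays: 0 the input; 1 the number of vectors found; 2 the current
   partial policy, with [a.+1] for action [a] and 0 where it is undefined;
   3 to 8 loop counters (round, sweep, action, state, row, column).
   Real arrays: 0 to 3 the input; 4, 5, 6 the output, where 6 holds the part of
   the flow that remains to be decomposed; 7 the inverse matrix; 8 the pivot
   row; 9 zero; 10 the remaining mass; 11 the leak; 12 to 14 temporaries;
   15 one. *)
Definition scal (a : nat) : rloc := RLoc a (NConst 0) (NConst 0).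

Definition reset_prog : fcmd :=
  FFor 7 0 (FSeq (FNat 2 (nvar 7) (NConst 0))
    (FSeq (FFor 8 0 (FConst (RLoc 7 (nvar 7) (nvar 8)) 0))
      (FConst (RLoc 7 (nvar 7) (nvar 7)) 1))).

Definition leak_prog : fcmd :=
  FSeq (FConst (scal 11) 1)
    (FFor 7 0 (FIf (TNle (NRead 2 (nvar 7)) (NConst 0))
      (FOp RSub (scal 11) (scal 11) (RLoc 1 (nvar 5) (nvar 7))) FSkip)).

Definition row_prog : fcmd :=
  FFor 8 0 (FSeq (FConst (RLoc 8 (NConst 0) (nvar 8)) 0)
    (FFor 7 0 (FSeq
      (FOp RMul (scal 12) (RLoc 1 (nvar 5) (nvar 7)) (RLoc 7 (nvar 7) (nvar 8)))
      (FOp RAdd (RLoc 8 (NConst 0) (nvar 8)) (RLoc 8 (NConst 0) (nvar 8)) (scal 12))))).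

(** The update is in place: the factor of a row is saved in array 14 first, because the inner loop
    overwrites the entry in column [t] from which it is computed. *)
Definition pivot_prog : fcmd :=
  FSeq (FOp RSub (scal 13) (scal 15) (RLoc 8 (NConst 0) (nvar 6)))
    (FFor 7 0 (FSeq (FOp RDiv (scal 14) (RLoc 7 (nvar 7) (nvar 6)) (scal 13))
      (FFor 8 0 (FSeq (FOp RMul (scal 12) (scal 14) (RLoc 8 (NConst 0) (nvar 8)))
        (FOp RAdd (RLoc 7 (nvar 7) (nvar 8)) (RLoc 7 (nvar 7) (nvar 8)) (scal 12)))))).

Definition try_prog : fcmd :=
  FIf (TAnd (TNot (TRle (RLoc 0 (nvar 5) (nvar 6)) (scal 9)))
      (TAnd (TNle (NRead 2 (nvar 6)) (NConst 0))
        (TNot (TRle (RLoc 6 (nvar 5) (NConst 0)) (scal 9)))))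
    (FSeq leak_prog
      (FIf (TNot (TRle (scal 11) (scal 9)))
        (FSeq row_prog (FSeq pivot_prog (FNat 2 (nvar 6) (NSucc (nvar 5))))) FSkip))
    FSkip.

(** A sweep that adds no state proves saturation, and at most [n] sweeps can add one, so [n] sweeps
    suffice. *)
Definition grow_prog : fcmd := FFor 4 0 (FFor 5 1 (FFor 6 0 try_prog)).

Definition in_domain : test := TNle (NConst 1) (NRead 2 (nvar 6)).
Definition current_vec (j : nexp) : rloc := RLoc 4 (nvar 1) j.
Definition current_coef : rloc := RLoc 5 (nvar 1) (NConst 0).
Definition start : nexp := NRead 0 (NConst 2).
Definition chosen (t : nexp) : nexp := NPred (NRead 2 t).

(** Only entries of chosen actions are written; the others rely on the initial value 0 of array
    4. *)
Definition output_prog : fcmd :=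
  FFor 6 0 (FIf in_domain
    (FCopy (current_vec (chosen (nvar 6))) (RLoc 7 start (nvar 6))) FSkip).

(** The output cell holds the running minimum of the ratios. It starts at [s], where [N s s] is
    positive because time 0 counts as a visit. *)
Definition coef_prog : fcmd :=
  FSeq (FOp RDiv current_coef (RLoc 6 (chosen start) (NConst 0)) (RLoc 7 start start))
    (FFor 6 0 (FIf (TAnd in_domain (TNot (TRle (RLoc 7 start (nvar 6)) (scal 9))))
      (FSeq (FOp RDiv (scal 12) (RLoc 6 (chosen (nvar 6)) (NConst 0)) (RLoc 7 start (nvar 6)))
        (FIf (TRle (scal 12) current_coef) (FCopy current_coef (scal 12)) FSkip)) FSkip)).

Definition subtract_prog : fcmd :=
  FFor 6 0 (FIf in_domain
    (FSeq (FOp RMul (scal 12) current_coef (RLoc 7 start (nvar 6)))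
      (FOp RSub (RLoc 6 (chosen (nvar 6)) (NConst 0))
        (RLoc 6 (chosen (nvar 6)) (NConst 0)) (scal 12))) FSkip).

Definition round_prog : fcmd :=
  FSeq reset_prog (FSeq grow_prog (FSeq output_prog (FSeq coef_prog
    (FSeq subtract_prog (FSeq (FOp RSub (scal 10) (scal 10) current_coef)
      (FNat 1 (NConst 0) (NSucc (nvar 1)))))))).

(** A counted loop cannot stop early; the guard makes the rounds idle once the mass has vanished. *)
Definition main_prog : fcmd :=
  FSeq (FFor 5 1 (FCopy (RLoc 6 (nvar 5) (NConst 0)) (RLoc 3 (nvar 5) (NConst 0))))
    (FSeq (FConst (scal 15) 1) (FSeq (FConst (scal 10) 1)
      (FFor 3 1 (FIf (TNot (TRle (scal 10) (scal 9))) round_prog FSkip)))).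

Lemma main_prog_wf : wf main_prog. Proof. by []. Qed.

(** * Loop invariants and specifications of the subprograms *)

Section Specifications.
Variables (R : realType) (n m : nat) (I : ssp R n m) (s : 'I_n) (x : 'cV[R]_m).
Implicit Types (st : store R) (pi : {ffun 'I_n -> option 'I_m}) (N : 'M[R]_n).
Implicit Types (y : 'cV[R]_m) (t u : 'I_n) (a : 'I_m).

Local Notation G := (good_value I s x).
Local Notation P := (ssp_P I).
Local Notation J := (ssp_J I).

Definition ready st : Prop :=
  [/\ [/\ nmem st 0 0 = n, nmem st 0 1 = m & nmem st 0 2 = s],
      forall a t, rmem st 0 a t = (J a t)%:R,
      forall a t, rmem st 1 a t = P a t,
      rmem st 9 0 0 = 0
    & rmem st 15 0 0 = 1].

Definition static (c : fcmd) : bool :=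
  (0%N \notin nmods c) && all (fun k : nat => k \notin rmods c) [:: 0; 1; 9; 15]%N.

Lemma ready_frame c st st' : frame c st st' -> static c -> ready st -> ready st'.
Proof.
move=> [nf rf] /andP[n0 /and5P[r0 r1 r9 r15 _]] [[]].
by rewrite /ready nf // !rf.
Qed.

Lemma ready_rset st (a : nat) i j r : a \notin [:: 0; 1; 9; 15]%N -> ready st ->
  ready (rset st a i j r).
Proof.
rewrite !inE !negb_or !(eq_sym a) => /and4P[/negbTE r0 /negbTE r1 /negbTE r9 /negbTE r15].
by case=> nh Jh Ph zh oh; split=> //= *; rewrite ?r0 ?r1 ?r9 ?r15 /= ?Jh ?Ph.
Qed.

Definition holds_policy st pi : Prop :=
  forall t, nmem st 2 t = (if pi t is Some a then a.+1 else 0)%N.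
Definition holds_inverse st N : Prop := forall t u, rmem st 7 t u = N t u.
Definition holds_flow st y : Prop := forall a, rmem st 6 a 0 = y a 0.

Lemma reset_spec st : ready st ->
  wp G reset_prog (fun st' => holds_policy st' [ffun => None] /\ holds_inverse st' 1%:M) st.
Proof.
move=> rd; have [[n0 _ _] _ _ _ _] := rd.
apply: (@wp_for _ _ (fun j st' => forall t, (t < j)%N ->
  nmem st' 2 t = 0%N /\ forall u, rmem st' 7 t u = (t == u)%:R) _ _ _ _ _ n) => //.
  move=> i st1 i1 fr1 inv1.
  have [[n1 _ _] _ _ _ _] := ready_frame fr1 isT rd.
  apply: wp_seq; apply: wp_nat => //=; rewrite i1.
  apply: wp_seq; apply: (@wp_for _ _ (fun j st' =>
    (forall t, (t < i)%N -> forall u, rmem st' 7 t u = (t == u)%:R) /\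
    (forall u, (u < j)%N -> rmem st' 7 i u = 0)) _ _ _ _ _ n) => //=.
    by split=> // t ti; case: (inv1 t ti).
  - move=> j st2 j2 [nf2 _] [inv2 inv2'].
    have i2 : nmem st2 7 0 = i by rewrite (nf2 7%N isT).
    apply: wp_const => //=; first exact: good_value0.
    rewrite i2 j2; split=> [t ti|] u /=.
      by rewrite ltn_eqF //=; apply: inv2.
    rewrite eqxx /= ltnS leq_eqVlt; case: eqP => //= _.
    exact: inv2'.
  - move=> st2 [nf2 _] [inv2 inv2'].
    have i2 : nmem st2 7 0 = i by rewrite (nf2 7%N isT).
    apply: wp_const => //=; first exact: good_value1.
    rewrite i2 => t; rewrite ltnS leq_eqVlt; case: (t =P i :> nat) => [/val_inj ti _|ti /= lti].
      subst t; split=> [|u /=]; first by rewrite (nf2 2%N isT) /= eqxx.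
      rewrite [i == u]eq_sym -val_eqE /=; case: eqP => // _; exact: inv2'.
    split=> [|u]; last exact: inv2.
    by rewrite (nf2 2%N isT) /=; case: eqP => // _; case: (inv1 t lti).
move=> st' _ inv; split=> [t|t u]; rewrite ?ffunE; first by case: (inv t (ltn_ord t)).
by rewrite mxE; case: (inv t (ltn_ord t)).
Qed.

Lemma leak_spec st pi a : ready st -> holds_policy st pi -> nmem st 5 0 = a ->
  wp G leak_prog (fun st' => rmem st' 11 0 0 = leak I pi a) st.
Proof.
move=> rd hp a0; apply: wp_seq; apply: wp_const => //=; first exact: good_value1.
set st0 := rset _ _ _ _ _; have {}rd : ready st0 by apply: ready_rset.
have [[n0 _ _] _ _ _ _] := rd.
apply: (@wp_for _ _ (fun j st' => rmem st' 11 0 0 =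
  1 - \sum_(u < n | (u < j)%N && (pi u == None)) P a u) _ _ _ _ _ n) => //=.
- by rewrite big_pred0 ?subr0.
- move=> i st1 i1 fr1 inv1; have [[n1 _ _] _ P1 _ _] := ready_frame fr1 isT rd.
  have [nf1 _] := fr1.
  have hp1 : nmem st1 2 i = (if pi i is Some b then b.+1 else 0)%N.
    by rewrite (nf1 2%N isT); apply: hp.
  have a1 : nmem st1 5 0 = a by rewrite (nf1 5%N isT).
  have eqS : 1 - \sum_(u < n | (u < i.+1)%N && (pi u == None)) P a u =
      1 - \sum_(u < n | (u < i)%N && (pi u == None)) P a u - (if pi i == None then P a i else 0).
    by rewrite sum_ltS opprD addrA.
  apply: wp_if => /=; rewrite i1 hp1; case pii: (pi i) eqS => [b|] //= eqS _.
  + apply: (wp_op (r := 1 - \sum_(u < n | (u < i.+1)%N && (pi u == None)) P a u)) => //=.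
      by rewrite inv1 i1 a1 P1 -eqS.
    exact: good_leak.
  + by rewrite /wp /= inv1 eqS subr0.
- by move=> st' _ ->; rewrite /leak; congr (1 - _); apply: sum_ltT.
Qed.

Lemma row_spec st pi N a : ready st -> transient I pi N -> holds_inverse st N ->
  nmem st 5 0 = a ->
  wp G row_prog (fun st' => forall u, rmem st' 8 0 u = pivot_row I N a 0 u) st.
Proof.
move=> rd trN hN a0; have [[n0 _ _] _ _ _ _] := rd.
apply: (@wp_for _ _ (fun j st' => forall u, (u < j)%N ->
  rmem st' 8 0 u = pivot_row I N a 0 u) _ _ _ _ _ n) => //.
- move=> j st1 j1 fr1 inv1; have rd1 := ready_frame fr1 isT rd.
  have [nf1 rf1] := fr1.
  apply: wp_seq; apply: wp_const => //=; first exact: good_value0.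
  rewrite j1; set st0 := rset _ _ _ _ _.
  have {}rd1 : ready st0 by apply: ready_rset.
  have [[n1 _ _] _ _ _ _] := rd1.
  apply: (@wp_for _ _ (fun i st' =>
     (forall u, (u < j)%N -> rmem st' 8 0 u = pivot_row I N a 0 u) /\
     rmem st' 8 0 j = \sum_(t < n | (t < i)%N && true) P a t * N t j) _ _ _ _ _ n) => //.
  + split=> [u uj|] /=; last by rewrite eqxx big_pred0.
    by rewrite ltn_eqF // inv1.
  + move=> i st2 i2 fr2 [inv2 inv2']; have [_ _ P2 _ _] := ready_frame fr2 isT rd1.
    have [nf2 rf2] := fr2.
    have a2 : nmem st2 5 0 = a by rewrite (nf2 5%N isT) /= (nf1 5%N isT).
    have j2 : nmem st2 8 0 = j by rewrite (nf2 8%N isT).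
    have N2 : rmem st2 7 i j = N i j.
      by rewrite (rf2 7%N isT) /= (rf1 7%N isT) hN.
    apply: wp_seq; apply: (wp_op (r := P a i * N i j)) => //=.
    + by rewrite a2 i2 j2 P2 N2.
    + exact: (good_PN trN).
    apply: (wp_op (r := \sum_(t < n | (t < i.+1)%N && true) P a t * N t j)) => //=.
    + by rewrite j2 inv2' sum_ltS.
    + exact: (good_pivot_row trN).
    rewrite j2; split=> [u uj|] /=; first by rewrite ltn_eqF // inv2.
    by rewrite eqxx.
  + move=> st2 _ [inv2 inv2'] u; rewrite ltnS leq_eqVlt.
    case: (u =P j :> nat) => [/val_inj -> _|_ /=]; last exact: inv2.
    by rewrite /= inv2' sum_ltT pivot_rowE.
- by move=> st' _ inv u; apply: inv.
Qed.

Lemma pivot_spec st pi N a t : ready st -> transient I pi N -> pi t = None ->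
  0 < leak I pi a -> holds_inverse st N -> nmem st 6 0 = t ->
  (forall u, rmem st 8 0 u = pivot_row I N a 0 u) ->
  wp G pivot_prog (fun st' => holds_inverse st' (pivot_mx I N t a)) st.
Proof.
move=> rd trN pit lk hN t0 hW; have [_ _ _ _ o0] := rd.
have trN' := transient_extend trN pit lk.
apply: wp_seq; apply: (wp_op (r := 1 - pivot_row I N a 0 t)) => //=.
- by rewrite o0 t0 hW.
- exact: (good_pivot trN).
set st0 := rset _ _ _ _ _.
have {}rd : ready st0 by apply: ready_rset.
have [[n0 _ _] _ _ _ _] := rd.
apply: (@wp_for _ _ (fun j st' => forall (i : 'I_n) u, rmem st' 7 i u =
  if (i < j)%N then pivot_mx I N t a i u else N i u) _ _ _ _ _ n) => //.
- move=> i st1 i1 fr1 inv1; have rd1 := ready_frame fr1 isT rd.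
  have [nf1 rf1] := fr1.
  have t1 : nmem st1 6 0 = t by rewrite (nf1 6%N isT).
  have d1 : rmem st1 13 0 0 = 1 - pivot_row I N a 0 t by rewrite (rf1 13%N isT).
  apply: wp_seq; apply: (wp_op (r := N i t / (1 - pivot_row I N a 0 t))) => //=.
  - by rewrite i1 t1 d1 inv1 ltnn.
  - exact: (good_factor trN).
  set st1' := rset _ _ _ _ _.
  have {}rd1 : ready st1' by apply: ready_rset.
  have [[n1 _ _] _ _ _ _] := rd1.
  apply: (@wp_for _ _ (fun j st' => forall (k : 'I_n) u, rmem st' 7 k u =
    if (k < i)%N || (k == i) && (u < j)%N then pivot_mx I N t a k u else N k u) _ _ _ _ _ n) => //.
  + by move=> k u; rewrite /= inv1 andbF orbF.
  + move=> j st2 j2 fr2 inv2; have [nf2 rf2] := fr2.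
    have i2 : nmem st2 7 0 = i by rewrite (nf2 7%N isT).
    have f2 : rmem st2 14 0 0 = N i t / (1 - pivot_row I N a 0 t) by rewrite (rf2 14%N isT).
    have W2 : rmem st2 8 0 j = pivot_row I N a 0 j.
      by rewrite (rf2 8%N isT) /= (rf1 8%N isT) /= hW.
    apply: wp_seq; apply: (wp_op (r := N i t / (1 - pivot_row I N a 0 t) * pivot_row I N a 0 j)) => //=.
    + by rewrite f2 j2 W2.
    + exact: (good_update trN).
    apply: (wp_op (r := pivot_mx I N t a i j)) => //=.
    + by rewrite i2 j2 inv2 ltnn eqxx ltnn /= pivot_mxE.
    + exact: (good_N trN' a).
    move=> k u /=; rewrite i2 j2 inv2 ltnS [(u <= j)%N]leq_eqVlt -!val_eqE /=.
    case: (k =P i :> nat) => [/val_inj ->|_] /=; last by [].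
    rewrite ltnn /=; by case: (u =P j :> nat) => [/val_inj ->|].
  + move=> st2 _ inv2 k u; rewrite /= inv2 ltn_ord andbT ltnS.
    by rewrite [(k <= i)%N]leq_eqVlt orbC.
- by move=> st' _ inv i u; rewrite inv ltn_ord.
Qed.

Definition compatible y pi : Prop := forall t a, pi t = Some a -> J a t /\ 0 < y a 0.

Definition blocked y pi a t : Prop :=
  J a t -> pi t = None -> 0 < y a 0 -> leak I pi a <= 0.

Definition domain_size pi : nat := #|[set t | pi t != None]|.

Definition grown st y pi N : Prop :=
  [/\ holds_policy st pi, holds_inverse st N, transient I pi N & compatible y pi].

Lemma grown_eq st st' y pi N : nmem st' 2 = nmem st 2 -> rmem st' 7 = rmem st 7 ->
  grown st y pi N -> grown st' y pi N.
Proof.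
by move=> n2 r7 [hp hN trN co]; split=> // [t|t u]; [rewrite n2|rewrite r7].
Qed.

Lemma domain_size_extend pi t a : pi t = None ->
  domain_size (extend pi t a) = (domain_size pi).+1.
Proof.
move=> pit; rewrite /domain_size.
rewrite (_ : [set u | extend pi t a u != None] = t |: [set u | pi u != None]).
  by rewrite cardsU1 inE pit.
by apply/setP => u; rewrite !inE ffunE; case: (u =P t).
Qed.

(** The second outcome records that the pair was not blocked, which rules out an extension after
    saturation. *)
Lemma try_spec st y pi N a t : ready st -> holds_flow st y -> grown st y pi N ->
  nmem st 5 0 = a -> nmem st 6 0 = t ->
  wp G try_prog (fun st' => (grown st' y pi N /\ blocked y pi a t) \/
    exists pi' N', [/\ grown st' y pi' N', domain_size pi' = (domain_size pi).+1
                     & ~ blocked y pi a t]) st.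
Proof.
move=> rd hy gr a0 t0; have [hp hN trN co] := gr; have [_ J0 _ z0 _] := rd.
apply: wp_if => /=; rewrite a0 t0 z0 J0 hp hy; last first.
  move=> cond; left; split=> // Jat pit ya.
  by move: cond; rewrite Jat pit -!ltNge ya ltr01.
case Jat: (J a t); last by rewrite lexx.
case pit: (pi t) => [b|]; first by rewrite ltn0 andbF.
rewrite -!ltNge ltr01 /= => ya.
apply: wp_seq; apply: (wp_conseq (leak_spec rd hp a0)) => st1 fr1 lk1.
have rd1 := ready_frame fr1 isT rd; have [_ _ _ z1 _] := rd1.
have [nf1 rf1] := fr1.
have gr1 : grown st1 y pi N by apply: grown_eq gr; rewrite ?(nf1 2%N isT) ?(rf1 7%N isT).
apply: wp_if => /=; rewrite lk1 z1; last first.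
  by rewrite negbK => lk; left; split.
rewrite -ltNge => lk; have [_ hN1 _ _] := gr1.
have a1 : nmem st1 5 0 = a by rewrite (nf1 5%N isT).
apply: wp_seq; apply: (wp_conseq (row_spec rd1 trN hN1 a1)) => st2 fr2 W2.
have rd2 := ready_frame fr2 isT rd1; have [nf2 rf2] := fr2.
have hN2 : holds_inverse st2 N by move=> u v; rewrite (rf2 7%N isT) hN1.
have t2 : nmem st2 6 0 = t by rewrite (nf2 6%N isT) (nf1 6%N isT).
apply: wp_seq; apply: (wp_conseq (pivot_spec rd2 trN pit lk hN2 t2 W2)) => st3 fr3 N3.
have [nf3 _] := fr3.
apply: wp_nat => //=; rewrite (nf3 6%N isT) t2 (nf3 5%N isT) (nf2 5%N isT) a1.
right; exists (extend pi t a), (pivot_mx I N t a); split; last first.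
- by move=> /(_ Jat pit ya); rewrite leNgt lk.
- exact: domain_size_extend.
split=> //; last first.
- move=> u b; rewrite ffunE; case: (u =P t) => [->|_]; last exact: co.
  by case=> <-.
- exact: transient_extend.
move=> u; rewrite /= ffunE -val_eqE /=; case: (u =P t :> nat) => // _.
by rewrite (nf3 2%N isT) (nf2 2%N isT) (nf1 2%N isT) hp.
Qed.

(** The three states of sweep [r]: the domain already exceeds [r]; it has at least [r] states and
    all pairs examined in this sweep are blocked; or saturation is reached. An extension always
    leads to the first. *)
Definition progress y (r : nat) (done : 'I_m -> 'I_n -> bool) pi : Prop :=
  [\/ (r < domain_size pi)%N,
      (r <= domain_size pi)%N /\ forall a t, done a t -> blocked y pi a t
    | forall a t, blocked y pi a t].

Lemma progress_eq y r (d d' : 'I_m -> 'I_n -> bool) pi : (forall a t, d' a t -> d a t) ->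
  progress y r d pi -> progress y r d' pi.
Proof.
move=> dd [?|[rd db]|?]; [exact: Or31| |exact: Or33].
by apply: Or32; split=> // a t /dd; apply: db.
Qed.

Lemma grow_spec st y pi N : ready st -> holds_flow st y -> grown st y pi N ->
  wp G grow_prog (fun st' => exists pi' N', grown st' y pi' N' /\
    forall a t, blocked y pi' a t) st.
Proof.
move=> rd hy gr; have [[n0 _ _] _ _ _ _] := rd.
apply: (@wp_for _ _ (fun r st' => exists pi' N', grown st' y pi' N' /\
  ((r <= domain_size pi')%N \/ forall a t, blocked y pi' a t)) _ _ _ _ _ n) => //.
- by exists pi, N; split; [apply: grown_eq gr|left].
- move=> r st1 _ fr1 [pi1 [N1 [gr1 pr1]]]; have rd1 := ready_frame fr1 isT rd.
  have hy1 : holds_flow st1 y by move=> a; rewrite (fr1.2 6%N isT) hy.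
  have [[_ m1 _] _ _ _ _] := rd1.
  apply: (@wp_for _ _ (fun j st' => exists pi' N', grown st' y pi' N' /\
    progress y r (fun a _ => (a < j)%N) pi') _ _ _ _ _ m) => //.
  + exists pi1, N1; split; first exact: grown_eq gr1.
    by case: pr1 => [r1|bl]; [apply: Or32; split|apply: Or33].
  + move=> a st2 a2 fr2 [pi2 [N2 [gr2 pr2]]]; have rd2 := ready_frame fr2 isT rd1.
    have hy2 : holds_flow st2 y by move=> b; rewrite (fr2.2 6%N isT) hy1.
    have [[n2 _ _] _ _ _ _] := rd2.
    apply: (@wp_for _ _ (fun i st' => exists pi' N', grown st' y pi' N' /\
      progress y r (fun b t => (b < a)%N || (b == a) && (t < i)%N) pi') _ _ _ _ _ n) => //.
    * exists pi2, N2; split; first exact: grown_eq gr2.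
      by apply: progress_eq pr2 => b t; rewrite andbF orbF.
    * move=> t st3 t3 fr3 [pi3 [N3 [gr3 pr3]]]; have rd3 := ready_frame fr3 isT rd2.
      have hy3 : holds_flow st3 y by move=> b; rewrite (fr3.2 6%N isT) hy2.
      have a3 : nmem st3 5 0 = a by rewrite (fr3.1 5%N isT).
      apply: (wp_conseq (try_spec rd3 hy3 gr3 a3 t3)) => st4 _ [[gr4 bl]|].
        exists pi3, N3; split; first exact: grown_eq gr4.
        case: pr3 => [?|[r3 b3]|?]; [exact: Or31| |exact: Or33].
        apply: Or32; split=> // b u; rewrite ltnS [(u <= t)%N]leq_eqVlt andb_orr orbCA.
        case/orP => [/andP[/eqP -> /eqP/val_inj -> //]|]; exact: b3.
      move=> [pi4 [N4 [gr4 D4 nbl]]]; exists pi4, N4; split; first exact: grown_eq gr4.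
      apply: Or31; rewrite D4 ltnS.
      by case: pr3 => [/ltnW|[]|/(_ a t)].
    * move=> st3 _ [pi3 [N3 [gr3 pr3]]]; exists pi3, N3; split; first exact: grown_eq gr3.
      by apply: progress_eq pr3 => b t; rewrite ltn_ord andbT ltnS [(b <= a)%N]leq_eqVlt orbC.
  + move=> st2 _ [pi2 [N2 [gr2 pr2]]]; exists pi2, N2; split; first exact: grown_eq gr2.
    case: pr2 => [r2|[r2 b2]|]; [by left| |by right].
    by right=> a t; apply: b2.
(* If the domain has reached size [n], no state [t] without a choice is left to be blocked. *)
- move=> st' _ [pi' [N' [gr' [nd|bl]]]]; exists pi', N'; split=> // a t _ pit.
  suff: (domain_size pi' < n)%N by rewrite ltnNge nd.
  rewrite /domain_size -[X in (_ < X)%N]card_ord -cardsT proper_card //.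
  by apply/properP; split; [apply: finset.subsetT|exists t; rewrite ?inE ?pit].
Qed.

Section Round.
Variables (y : 'cV[R]_m) (pi : {ffun 'I_n -> option 'I_m}) (N : 'M[R]_n) (k i : nat).
Hypotheses (trN : transient I pi N) (co : compatible y pi).

Local Notation f := (policy_flux pi N s).

Let piJ t a (e : pi t = Some a) : J a t := (co e).1.

(** An action belongs to one state only, so a loop over the states has not touched the entry of [a]
    before it reaches [t]. *)
Lemma sum_chosen0 t a : pi t = Some a ->
  \sum_(u < n | (u < t)%N && (pi u == Some a)) N s u = 0.
Proof.
move=> pit; rewrite big_pred0 // => u; apply/negP => /andP[ut /eqP pu].
by rewrite (pi_inj piJ pu pit) ltnn in ut.
Qed.

Lemma output_spec st : ready st -> holds_policy st pi -> holds_inverse st N ->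
  nmem st 1 0 = k -> (forall a, rmem st 4 k a = 0) ->
  wp G output_prog (fun st' => (forall a, rmem st' 4 k a = f a 0) /\
    forall j a, j != k -> rmem st' 4 j a = rmem st 4 j a) st.
Proof.
move=> rd hp hN k0 z0; have [[n0 _ _] _ _ _ _] := rd.
apply: (@wp_for _ _ (fun j st' =>
  (forall a, rmem st' 4 k a = \sum_(t < n | (t < j)%N && (pi t == Some a)) N s t) /\
  forall r a, r != k -> rmem st' 4 r a = rmem st 4 r a) _ _ _ _ _ n) => //.
- by split=> // a; rewrite sum_lt0 /= z0.
- move=> t st1 t1 fr1 [inv1 inv1']; have [nf1 rf1] := fr1.
  have [[_ _ s1] _ _ _ _] := ready_frame fr1 isT rd.
  have hp1 : holds_policy st1 pi by move=> u; rewrite (nf1 2%N isT).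
  have k1 : nmem st1 1 0 = k by rewrite (nf1 1%N isT).
  apply: wp_if => /=; rewrite t1 hp1; case pit: (pi t) => [a|] //= _.
    apply: (wp_copy (r := N s t)) => //=.
    + by rewrite s1 t1 (rf1 7%N isT) hN.
    + exact: (good_N trN a).
    rewrite k1 t1 hp1 pit /=; split=> [b|r b /negbTE rk] /=; last first.
      by rewrite rk /= inv1' // rk.
    rewrite eqxx sum_ltS inv1 pit (inj_eq Some_inj) eq_sym -val_eqE /=.
    case: (a =P b :> nat) => [/val_inj <-|_]; last by rewrite addr0.
    by rewrite sum_chosen0 // add0r.
  by split=> // b; rewrite /= sum_ltS inv1 pit addr0.
- move=> st' _ [inv inv']; split=> // a; rewrite inv mxE.
  exact: sum_ltT.
Qed.

Hypothesis ty : tame I s x i y.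

Lemma coef_spec st : ready st -> holds_policy st pi -> holds_inverse st N ->
  holds_flow st y -> nmem st 1 0 = k -> pi s != None ->
  wp G coef_prog (fun st' => exists t a,
   [/\ pi t = Some a, 0 < N s t, rmem st' 5 k 0 = y a 0 / N s t,
       forall u b, pi u = Some b -> 0 < N s u -> y a 0 / N s t <= y b 0 / N s u
     & forall j, j != k -> rmem st' 5 j 0 = rmem st 5 j 0]) st.
Proof.
move=> rd hp hN hy k0; case ps: (pi s) => [a|] // _.
have [[_ _ s0] _ _ _ _] := rd.
apply: wp_seq; apply: (wp_op (r := y a 0 / N s s)) => //=.
- by rewrite s0 hp ps hy hN.
- exact: (good_ratio trN _ _ ty).
rewrite k0; set st0 := rset _ _ _ _ _; have {}rd : ready st0 by apply: ready_rset.
have [[n0 _ _] _ _ _ _] := rd.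
apply: (@wp_for _ _ (fun r st' => exists t a,
   [/\ pi t = Some a, 0 < N s t, rmem st' 5 k 0 = y a 0 / N s t,
       forall u b, (u < r)%N -> pi u = Some b -> 0 < N s u ->
         y a 0 / N s t <= y b 0 / N s u
     & forall j, j != k -> rmem st' 5 j 0 = rmem st 5 j 0]) _ _ _ _ _ n) => //.
- exists s, a; split=> //=; rewrite ?eqxx //; first exact: (policy_flux_diag s trN).
  by move=> j /negbTE ->.
- move=> u st1 u1 fr1 [t [b [pit Nt e1 min1 o1]]]; have [nf1 rf1] := fr1.
  have rd1 := ready_frame fr1 isT rd; have [[_ _ s1] _ _ z1 _] := rd1.
  have hp1 : nmem st1 2 u = (if pi u is Some b then b.+1 else 0)%N.
    by rewrite (nf1 2%N isT); apply: hp.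
  have hN1 : rmem st1 7 s u = N s u by rewrite (rf1 7%N isT); apply: hN.
  have k1 : nmem st1 1 0 = k by rewrite (nf1 1%N isT).
  apply: wp_if => /=; rewrite u1 hp1 s1 hN1 z1; last first.
    move=> cond; exists t, b; split=> // v d; rewrite ltnS leq_eqVlt.
    case: (v =P u :> nat) => [/val_inj -> _|_ /= vu]; last exact: min1.
    by move=> pu Nu; move: cond; rewrite pu -ltNge Nu.
  case pu: (pi u) => [c|] //=; rewrite -ltNge => Nu.
  apply: wp_seq; apply: (wp_op (r := y c 0 / N s u)) => //=.
  + by rewrite u1 hp1 s1 pu hN1 (rf1 6%N isT) /= hy.
  + exact: (good_ratio trN _ _ ty).
  apply: wp_if => /=; rewrite k1 e1.
    move=> le; apply: (wp_copy (r := y c 0 / N s u)) => //=.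
    + exact: (good_ratio trN _ _ ty).
    rewrite k1; exists u, c; split=> //=; rewrite ?eqxx //; last first.
      by move=> j jk; rewrite (negbTE jk) /= o1.
    move=> v d; rewrite ltnS leq_eqVlt.
    case: (v =P u :> nat) => [/val_inj -> _|_ /= vu pv Nv].
      by rewrite pu => -[->].
    by apply: le_trans le _; apply: min1.
  rewrite -ltNge => lt; exists t, b; split=> //= v d; rewrite ltnS leq_eqVlt.
  case: (v =P u :> nat) => [/val_inj -> _|_ /= vu]; last exact: min1.
  by rewrite pu => -[<-] _; apply: ltW.
- move=> st' _ [t [b [pit Nt e min o]]]; exists t, b; split=> // u d.
  exact: min.
Qed.

Lemma subtract_spec st t a : ready st -> holds_policy st pi -> holds_inverse st N ->
  holds_flow st y -> nmem st 1 0 = k -> rmem st 5 k 0 = y a 0 / N s t ->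
  tame I s x i.+1 (y - (y a 0 / N s t) *: f) ->
  wp G subtract_prog (fun st' => holds_flow st' (y - (y a 0 / N s t) *: f)) st.
Proof.
move=> rd hp hN hy k0 l0 ty'; have [[n0 _ _] _ _ _ _] := rd.
set lam := y a 0 / N s t in l0 ty' *.
have y'E b : (y - lam *: f) b 0 = y b 0 - lam * f b 0 by rewrite !mxE.
apply: (@wp_for _ _ (fun j st' => forall b : 'I_m, rmem st' 6 b 0 =
  y b 0 - lam * \sum_(u < n | (u < j)%N && (pi u == Some b)) N s u) _ _ _ _ _ n) => //.
- by move=> b; rewrite sum_lt0 mulr0 subr0; apply: hy.
- move=> u st1 u1 fr1 inv1; have [nf1 rf1] := fr1.
  have [[_ _ s1] _ _ _ _] := ready_frame fr1 isT rd.
  have hp1 : nmem st1 2 u = (if pi u is Some b then b.+1 else 0)%N.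
    by rewrite (nf1 2%N isT); apply: hp.
  have hN1 : rmem st1 7 s u = N s u by rewrite (rf1 7%N isT); apply: hN.
  have k1 : nmem st1 1 0 = k by rewrite (nf1 1%N isT).
  apply: wp_if => /=; rewrite u1 hp1; case pu: (pi u) => [c|] //= _; last first.
    by move=> b; rewrite /= inv1 sum_ltS pu addr0.
  apply: wp_seq; apply: (wp_op (r := lam * N s u)) => //=.
  + by rewrite k1 s1 u1 hN1 (rf1 5%N isT) l0.
  + exact: (good_decrement trN _ _ _ ty).
  apply: (wp_op (r := (y - lam *: f) c 0)) => //=.
  + rewrite u1 hp1 pu /= inv1 sum_chosen0 // mulr0 subr0 y'E.
    by rewrite (policy_fluxE _ _ piJ pu).
  + exact: (good_flow _ ty').
  move=> b; rewrite /= u1 hp1 pu /= andbT sum_ltS inv1 pu (inj_eq Some_inj).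
  case: (b =P c :> nat) => [/val_inj ->|bc].
    by rewrite eqxx sum_chosen0 // add0r y'E (policy_fluxE _ _ piJ pu).
  case: (c =P b) => [cb|_]; last by rewrite addr0.
  by case: bc; rewrite cb.
- by move=> st' _ inv b; rewrite inv y'E mxE sum_ltT.
Qed.

End Round.

Definition flux_vector (f : 'cV[R]_m) : Prop :=
  feasible I s f /\ exists Pi : policy I,
    [/\ proper_policy Pi s, deterministic Pi, stationary Pi & f = flux Pi s].

Lemma policy_flux_vector pi N y : transient I pi N -> compatible y pi ->
  closed_under I pi -> pi s != None -> flux_vector (policy_flux pi N s).
Proof.
move=> trN co clo ps; have piJ t a (e : pi t = Some a) : J a t := (co _ _ e).1.
split; first by split; [apply: policy_flux_ge0 trN|apply: policy_flux_balance].
exists (stationary_policy piJ); split.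
- exact: (stationary_policy_proper trN clo ps).
- exact: stationary_policy_deterministic.
- exact: stationary_policy_stationary.
- by rewrite (stationary_policy_flux _ trN clo ps).
Qed.

Lemma balanceB y z (l : R) : balance I (y - l *: z) = balance I y - l *: balance I z.
Proof. by rewrite /balance mulmxBr -scalemxAr. Qed.

(** Minimality of the ratio keeps [y'] nonnegative. Its source mass [mu - lam] is then nonnegative
    by [balance_ge0], which bounds [lam] by [mu] without any estimate. *)
Lemma ratio_step y mu pi N t a : nonneg y -> balance I y = mu *: delta_mx s 0 ->
  transient I pi N -> compatible y pi -> closed_under I pi -> pi s != None ->
  pi t = Some a -> 0 < N s t ->
  (forall u b, pi u = Some b -> 0 < N s u -> y a 0 / N s t <= y b 0 / N s u) ->
  let lam := y a 0 / N s t in let y' := y - lam *: policy_flux pi N s in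
  [/\ 0 <= lam <= mu, forall b, 0 <= y' b 0 <= y b 0, y' a 0 = 0, 0 < y a 0
    & balance I y' = (mu - lam) *: delta_mx s 0].
Proof.
move=> y0 bal trN co clo ps pit Nt min lam y'.
have piJ u b (e : pi u = Some b) : J b u := (co _ _ e).1.
have l0 : 0 <= lam by rewrite divr_ge0 // ltW.
have y'E b : y' b 0 = y b 0 - lam * policy_flux pi N s b 0 by rewrite !mxE.
have bal' : balance I y' = (mu - lam) *: delta_mx s 0.
  by rewrite balanceB bal (policy_flux_balance trN clo ps piJ) scalerBl.
have y'0 b : 0 <= y' b 0 <= y b 0.
  rewrite y'E gerBl mulr_ge0 ?(policy_flux_ge0 s trN) // andbT subr_ge0.
  case: (pickP (fun u => pi u == Some b)) => [u /eqP pu|none]; last first.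
    by rewrite mxE big_pred0 // mulr0.
  rewrite (policy_fluxE _ _ piJ pu); have [_ N0 _] := trN.
  have := N0 s u; rewrite le_eqVlt => /predU1P[<-|Nu]; first by rewrite mulr0.
  by rewrite -ler_pdivlMr //; apply: min.
split=> //; first 1 last.
- by rewrite y'E (policy_fluxE _ _ piJ pit) divfK ?subrr // gt_eqF.
- by case: (co _ _ pit).
rewrite l0 -subr_ge0; apply: (balance_ge0 _ bal') => b.
by case/andP: (y'0 b).
Qed.

Definition support_size y : nat := #|[set a | 0 < y a 0]|.

(* The state of the main loop after [it] rounds, the first [k] of which produced
   the vectors [xs j] with coefficients [lam j]. *)
Record decomposed st (it k : nat) (xs : nat -> 'cV[R]_m) (lam : nat -> R) y (mu : R)
    : Prop := Decomposed {
  dec_count : nmem st 1 0 = k;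
  dec_stop : k = it \/ mu = 0;
  dec_flow : holds_flow st y;
  dec_mass : rmem st 10 0 0 = mu;
  dec_mass_ge0 : 0 <= mu;
  dec_massE : mu = 1 - \sum_(j < k) lam j;
  dec_sum : x = \sum_(j < k) lam j *: xs j + y;
  dec_balance : balance I y = mu *: delta_mx s 0;
  dec_tame : tame I s x k y;
  dec_support : (k + support_size y <= m)%N;
  dec_coef : forall j, (j < k)%N -> rmem st 5 j 0 = lam j /\ 0 <= lam j;
  dec_vec : forall j, (j < k)%N ->
    (forall a, rmem st 4 j a = xs j a 0) /\ flux_vector (xs j);
  dec_fresh : forall j a, (k <= j)%N -> rmem st 4 j a = 0 }.

Lemma decomposed_eq st st' it k xs lam y mu :
  nmem st' 1 = nmem st 1 -> rmem st' 4 = rmem st 4 -> rmem st' 5 = rmem st 5 ->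
  rmem st' 6 = rmem st 6 -> rmem st' 10 = rmem st 10 ->
  decomposed st it k xs lam y mu -> decomposed st' it k xs lam y mu.
Proof.
move=> n1 r4 r5 r6 r10 [k0 stop hy hmu mu0 muE xE bal ty supp hl hx fresh].
split=> //; rewrite ?n1 ?r10 //.
- by move=> a; rewrite r6.
- by move=> j; rewrite r5; apply: hl.
- by move=> j jk; rewrite r4; apply: hx.
- by move=> j a; rewrite r4; apply: fresh.
Qed.

Lemma round_spec st it k xs lam y mu : ready st -> (it < m)%N -> 0 < mu ->
  decomposed st it k xs lam y mu ->
  wp G round_prog (fun st' => exists xs' lam' y' mu',
    decomposed st' it.+1 k.+1 xs' lam' y' mu') st.
Proof.
move=> rd itm mu0 [k0 stop hy hmu _ muE xE bal ty supp hl hx fresh].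
have y0 : nonneg y by case: ty => _ y0x _ a; case/andP: (y0x a).
apply: wp_seq; apply: (wp_conseq (reset_spec rd)) => st1 fr1 [hp1 hN1].
have rd1 := ready_frame fr1 isT rd; have [nf1 rf1] := fr1.
have hy1 : holds_flow st1 y by move=> a; rewrite (rf1 6%N isT).
have gr1 : grown st1 y [ffun => None] 1%:M.
  by split=> //; [apply: transient0|move=> t a; rewrite ffunE].
apply: wp_seq; apply: (wp_conseq (grow_spec rd1 hy1 gr1)).
move=> st2 fr2 [pi [N [[hp2 hN2 trN co] bl]]].
have rd2 := ready_frame fr2 isT rd1; have [nf2 rf2] := fr2.
have [ps clo] := saturated_closed y0 bal mu0 co bl.
have k2 : nmem st2 1 0 = k by rewrite (nf2 1%N isT) (nf1 1%N isT).
have z2 a : rmem st2 4 k a = 0 by rewrite (rf2 4%N isT) (rf1 4%N isT) fresh.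
apply: wp_seq; apply: (wp_conseq (output_spec trN co rd2 hp2 hN2 k2 z2)).
move=> st3 fr3 [v3 o3]; have rd3 := ready_frame fr3 isT rd2; have [nf3 rf3] := fr3.
have hp3 : holds_policy st3 pi by move=> t; rewrite (nf3 2%N isT).
have hN3 : holds_inverse st3 N by move=> t u; rewrite (rf3 7%N isT).
have hy3 : holds_flow st3 y by move=> a; rewrite (rf3 6%N isT) (rf2 6%N isT).
have k3 : nmem st3 1 0 = k by rewrite (nf3 1%N isT).
apply: wp_seq; apply: (wp_conseq (coef_spec trN ty rd3 hp3 hN3 hy3 k3 ps)).
move=> st4 fr4 [t [a [pit Nt l4 min o4]]].
have rd4 := ready_frame fr4 isT rd3; have [nf4 rf4] := fr4.
have hp4 : holds_policy st4 pi by move=> u; rewrite (nf4 2%N isT).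
have hN4 : holds_inverse st4 N by move=> u v; rewrite (rf4 7%N isT).
have hy4 : holds_flow st4 y by move=> b; rewrite (rf4 6%N isT).
have k4 : nmem st4 1 0 = k by rewrite (nf4 1%N isT).
have [l01 y'b y'a ya bal'] := ratio_step y0 bal trN co clo ps pit Nt min.
set l := y a 0 / N s t in l4 l01 y'b y'a bal' *.
set f := policy_flux pi N s in y'b y'a bal' *.
set y' := y - l *: f in y'b y'a bal' *.
(* The minimising action [a] leaves the support and no action enters it. *)
have supp' : (k.+1 + support_size y' <= m)%N.
  apply: leq_trans supp; rewrite addSnnS leq_add2l; apply: proper_card.
  apply/properP; split; last by exists a; rewrite !inE ?ya // y'a ltxx.
  apply/fintype.subsetP => b; rewrite !inE => /lt_le_trans; apply.
  by case/andP: (y'b b).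
have ty' : tame I s x k.+1 y'.
  split; first by apply: leq_trans supp'; rewrite leq_addr.
    move=> b; case/andP: (y'b b) => -> /le_trans; apply.
    by case: ty => _ /(_ b) /andP[].
  case: ty => _ _ cd rats numsE.
  exact: (common_denomS numsE a (cd _ numsE) trN Nt).
apply: wp_seq; apply: (wp_conseq (subtract_spec trN co ty rd4 hp4 hN4 hy4 k4 l4 ty')).
move=> st5 fr5 hy5; have [nf5 rf5] := fr5.
have k5 : nmem st5 1 0 = k by rewrite (nf5 1%N isT).
have l5 : rmem st5 5 k 0 = l by rewrite (rf5 5%N isT).
have mu5 : rmem st5 10 0 0 = mu.
  by rewrite (rf5 10%N isT) (rf4 10%N isT) (rf3 10%N isT) (rf2 10%N isT) (rf1 10%N isT).
have mu1 : mu <= 1.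
  rewrite muE gerBl sumr_ge0 // => j _; by case: (hl j (ltn_ord j)).
have mu'01 : 0 <= mu - l <= 1.
  by case/andP: l01 => l0 lmu; rewrite subr_ge0 lmu lerBlDr ler_wpDr.
have m0 : (0 < m)%N by apply: leq_ltn_trans itm.
apply: wp_seq; apply: (wp_op (r := mu - l)) => //=.
- by rewrite mu5 k5 l5.
- exact: (good_mass ty' m0 bal' mu'01).
apply: wp_nat => //=; rewrite k5.
have r4E : rmem st5 4 = rmem st3 4 by rewrite (rf5 4%N isT) (rf4 4%N isT).
have r4E' : rmem st2 4 = rmem st 4 by rewrite (rf2 4%N isT) (rf1 4%N isT).
have r5E : rmem st3 5 = rmem st 5.
  by rewrite (rf3 5%N isT) (rf2 5%N isT) (rf1 5%N isT).
exists (fun j => if j == k then f else xs j), (fun j => if j == k then l else lam j).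
exists y', (mu - l); split=> //=.
- left; case: stop => [->|mu00] //; by rewrite mu00 ltxx in mu0.
- by case/andP: mu'01.
- rewrite big_ord_recr /= eqxx muE opprD addrA; congr (1 - _ - _).
  by apply: eq_bigr => j _; rewrite ltn_eqF.
- rewrite big_ord_recr /= eqxx /y' -addrA [l *: f + _]addrC subrK [LHS]xE; congr (_ + _).
  by apply: eq_bigr => j _; rewrite ltn_eqF.
- move=> j; rewrite ltnS leq_eqVlt; case: (j =P k) => [-> _|/eqP jk /= jlt].
    by rewrite l5; split=> //; case/andP: l01.
  by rewrite (rf5 5%N isT) o4 // r5E; apply: hl.
- move=> j; rewrite ltnS leq_eqVlt; case: (j =P k) => [-> _|/eqP jk /= jlt].
    split; last exact: policy_flux_vector trN co clo ps.
    by move=> b; rewrite r4E v3.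
  have [h1 h2] := hx j jlt; split=> // b.
  by rewrite r4E o3 // r4E' h1.
- move=> j b kj; rewrite r4E o3 ?gtn_eqF // r4E' fresh // ltnW //.
Qed.

Hypothesis feas : feasible I s x.

Lemma main_spec st :
  nmem st 0 0 = n -> nmem st 0 1 = m -> nmem st 0 2 = s -> nmem st 1 0 = 0%N ->
  (forall a t, rmem st 0 a t = (J a t)%:R) -> (forall a t, rmem st 1 a t = P a t) ->
  (forall a, rmem st 3 a 0 = x a 0) -> (forall i j, rmem st 4 i j = 0) ->
  rmem st 9 0 0 = 0 ->
  wp G main_prog (fun st' => exists k xs lam y, decomposed st' m k xs lam y 0) st.
Proof.
move=> n0 m0 s0 k0 J0 P0 x0 r40 z0.
have [xge0 xbal] := feas.
have tx : tame I s x 0 x.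
  split=> // [a|rats numsE]; first by rewrite lexx andbT.
  exact: (common_denom0 numsE).
apply: wp_seq; apply: (@wp_for _ _ (fun j st' => forall a, (a < j)%N ->
  rmem st' 6 a 0 = x a 0) _ _ _ _ _ m) => //.
  move=> a st1 a1 [_ rf1] inv1; apply: (wp_copy (r := x a 0)) => //=.
    by rewrite a1 (rf1 3%N isT).
    exact: (good_flow _ tx).
  move=> b /=; rewrite a1 andbT ltnS leq_eqVlt.
  by case: (b =P a :> nat) => [/val_inj -> //|_ /=]; apply: inv1.
move=> st1 [nf1 rf1] hx1.
apply: wp_seq; apply: wp_const => //=; first exact: good_value1.
apply: wp_seq; apply: wp_const => //=; first exact: good_value1.
set st2 := rset _ _ _ _ _.
have rd2 : ready st2.
  split=> /=; rewrite ?(nf1 0%N isT) ?(rf1 9%N isT) //.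
    by move=> a t; rewrite (rf1 0%N isT).
  by move=> a t; rewrite (rf1 1%N isT).
have dec2 : decomposed st2 0 0 (fun=> 0) (fun=> 0) x 1.
  split=> //=; rewrite ?(nf1 1%N isT) //.
  - by left.
  - by move=> a /=; rewrite hx1.
  - by rewrite big_ord0 subr0.
  - by rewrite big_ord0 add0r.
  - by rewrite scale1r.
  - by rewrite add0n -[X in (_ <= X)%N]card_ord max_card.
  - by move=> j a _; rewrite (rf1 4%N isT).
have [[_ m2 _] _ _ _ _] := rd2.
apply: (@wp_for _ _ (fun it st' => exists k xs lam y mu,
  decomposed st' it k xs lam y mu) _ _ _ _ _ m) => //.
- by exists 0%N, (fun=> 0), (fun=> 0), x, 1; apply: decomposed_eq dec2.
- move=> it st3 _ fr3 [k [xs [lam [y [mu dec3]]]]].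
  have rd3 := ready_frame fr3 isT rd2; have [_ _ _ z3 _] := rd3.
  apply: wp_if => /=; rewrite (dec_mass dec3) z3.
    rewrite -ltNge => mu0.
    apply: wp_mono (round_spec rd3 (ltn_ord it) mu0 dec3).
    move=> st4 [xs' [lam' [y' [mu' dec4]]]].
    by exists k.+1, xs', lam', y', mu'; apply: decomposed_eq dec4.
  rewrite negbK => mu0; exists k, xs, lam, y, mu.
  have mu00 : mu = 0 by apply/eqP; rewrite eq_le mu0 (dec_mass_ge0 dec3).
  case: dec3 => *; split=> //; by right.
- move=> st3 _ [k [xs [lam [y [mu dec3]]]]]; exists k, xs, lam, y.
  suff mu0 : mu = 0 by rewrite mu0 in dec3.
  (* If all [m] rounds took place, [dec_support] leaves no action with positive flow; then [y] is 0
     and the balance at [s] forces [mu] to be 0. *)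
  have [_ [km|//] _ _ _ _ _ bal ty supp _ _ _] := dec3.
  have y00 : y = 0.
    apply/colP => a; rewrite mxE; apply/eqP; rewrite eq_le.
    case: ty => _ /(_ a)/andP[-> _] _; rewrite andbT leNgt; apply/negP => ya.
    move: supp; rewrite km -[leqRHS]addn0 leq_add2l leqn0 cards_eq0 => /eqP/setP/(_ a).
    by rewrite !inE ya.
  move: bal; rewrite y00 /balance mulmx0 => /colP/(_ s).
  by rewrite !mxE !eqxx mulr1.
Qed.

End Specifications.

Lemma mx_cellsE (R : realType) p q (A : 'M[R]_(p, q)) (i : 'I_p) (j : 'I_q) :
  mx_cells A i j = A i j.
Proof. by rewrite /mx_cells !valK. Qed.

(** * The initial store *)

Section Input.
Variables (R : realType) (n m : nat) (I : ssp R n m) (s : 'I_n) (x : 'cV[R]_m).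

Lemma good_input v : v \in input_numbers I s x -> good_value I s x v.
Proof.
move=> vin rats numsE; move: vin; rewrite numsE => /mapP[r rr ->]; exists r => //.
apply: leq_trans (rat_size_le rr) _; rewrite /size_bound; nia.
Qed.

Lemma good_mx_cells p q (A : 'M[R]_(p, q)) i j :
  {subset mx_entries A <= input_numbers I s x} -> good_value I s x (mx_cells A i j).
Proof.
move=> sub; rewrite /mx_cells; case: insub => [i'|]; last exact: good_value0.
case: insub => [j'|]; last exact: good_value0.
by apply/good_input/sub/mx_entries_mem.
Qed.

Lemma input_store_good : all_good (good_value I s x) (input_store I s x).
Proof.
case=> [|[|[|[|a]]]] i j; last exact: good_value0;
  apply: good_mx_cells => v vin; by rewrite !mem_cat vin ?orbT.
Qed.

(** Without actions the balance would be 0 at [s]. Positivity of [m] is also what bounds the loop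
    bound [n] by the number of input numbers. *)
Lemma feasible_actions : feasible I s x -> (0 < m)%N.
Proof.
case=> _ /colP/(_ s); rewrite balanceE mxE !eqxx.
case: m I x => // I' x'; rewrite !big_ord0 subrr => /esym/eqP.
by rewrite oner_eq0.
Qed.

End Input.

Theorem theorem1 (R : realType) :
  exists (prog : cmd) (p q : {poly nat}),
  forall (n m : nat) (I : ssp R n m) (s : 'I_n) (x : 'cV[R]_m),
    feasible I s x ->
    exists st : store R,
      strongly_polynomial_run prog p q
        (input_store I s x) (input_numbers I s x) st /\
      exists (k : nat) (xs : 'I_k -> 'cV[R]_m) (lam : 'I_k -> R)
             (xc : 'cV[R]_m),
        output_is st xs lam xc /\
        (1 <= k <= m)%N /\
        (forall j, 0 <= lam j <= 1) /\
        (forall j, feasible I s (xs j)) /\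
        balance I xc = 0 /\ nonneg xc /\
        \sum_j lam j = 1 /\
        x = \sum_j lam j *: xs j + xc /\
        (forall j, exists Pi : policy I,
          [/\ proper_policy Pi s, deterministic Pi, stationary Pi
            & xs j = flux Pi s]).
Proof.
exists (compile main_prog), (time main_prog).
(* This is [2 * size_bound L + 3], the bound in [good_value]. *)
exists (4%:P * 'X^3 + 16%:P * 'X^2 + 12%:P * 'X + 5%:P).
move=> n m I s x feas; have m0 := feasible_actions feas.
have dims b : (nmem (input_store I s x) 0 b <= size (input_numbers I s x))%N.
  rewrite size_input_numbers; have := ltn_ord s.
  by case: b => [|[|[|b]]] /=; rewrite ?nth_nil; nia.
have spec : wp (good_value I s x) main_prog
    (fun st' => exists k xs lam y, decomposed I s x st' m k xs lam y 0) (input_store I s x).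
  apply: main_spec => // [a t|a t|a].
  - by rewrite [LHS](mx_cellsE (ssp_Jmx I)) mxE.
  - exact: mx_cellsE.
  - exact: (mx_cellsE x a 0).
have [T [st [Tb rT [k [xs [lam [y dec]]]]]]] :=
  wp_runs main_prog_wf isT (@input_store_good R n m I s x) dims spec.
have [runT goodT] := rT [::].
exists st; split.
  exists T; split=> // rats numsE t tT a i j.
  have [r vr rs] := goodT t tT a i j rats numsE; exists r => //.
  apply: leq_trans rs _; rewrite !hornerD !hornerCM !hornerXn hornerX !hornerC.
  rewrite /size_bound -/(input_size rats) /= !natrXE.
  by move: (input_size rats) => L; rewrite /GRing.mul /GRing.add /=; nia.
have [k0 _ hy _ _ muE xE bal [km y0x _] _ hl hx _] := dec.
(* The remaining mass is 0. The sum being 1 also yields [1 <= k] and, with nonnegativity,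
   [lam j <= 1]. *)
have sum1 : \sum_(j < k) lam j = 1 by apply/eqP; rewrite eq_sym -subr_eq0 -muE.
have l0 (j : 'I_k) : 0 <= lam j by case: (hl j (ltn_ord j)).
exists k, (fun j => xs j), (fun j => lam j), y; split; last split.
- split=> //.
  + by move=> j a; case: (hx j (ltn_ord j)).
  + by move=> j; case: (hl j (ltn_ord j)).
- rewrite km andbT lt0n; apply/eqP => k00; move: sum1; rewrite k00 big_ord0 => /esym/eqP.
  by rewrite oner_eq0.
split=> [j|].
  by rewrite l0 -sum1 (bigD1 j) //= lerDl sumr_ge0.
split=> [j|]; first by case: (hx j (ltn_ord j)) => _ [].
split; first by rewrite bal scale0r.
split=> [a|]; first by case/andP: (y0x a).
by split=> //; split=> // j; case: (hx j (ltn_ord j)) => _ [].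
Qed.
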